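(* Let $q_{\mathrm B}=e^{\pi\mathrm i/6}$, $r=q_{\mathrm B}^3=\mathrm i$, $V=\mathbb C^3$, $G=q_{\mathrm B}^2R_3$, $E=I-\frac{G-G^{-1}}{q_{\mathrm B}-q_{\mathrm B}^{-1}}$. The representation $C_n(r,q_{\mathrm B})\to\mathrm{End}(V^{\otimes n})$, $g_i\mapsto G_i$, $e_i\mapsto E_i$, induces a faithful representation $$C_n^{\mathrm{ss}}(q_{\mathrm B}^3,q_{\mathrm B})\longrightarrow\mathrm{End}(V^{\otimes n})\qquad(n\ge2).$$ Consequently, $R_3$ is a strict localization of the semisimple BMW trace-quotient tower $(C_n^{\mathrm{ss}}(q_{\mathrm B}^3,q_{\mathrm B}))_n$ at $q_{\mathrm B}=e^{\pi\mathrm i/6}$.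
   Context: Let $\omega=e^{2\pi\mathrm i/3}$ and let $V=\mathbb C^3$ have orthonormal basis $e_x$, $x\in\mathbb F_3$. $R_3$ is the unitary Yang--Baxter operator $$R_3(e_x\otimes e_y)=3^{-1/2}\sum_{t\in\mathbb F_3}\omega^{t^2+t-(x+y)^2+(x+y)}\,e_{x+t}\otimes e_{y-t}.$$ A subscript $i$ on an operator on $V\otimes V$ denotes its copy on tensor factors $i,i+1$ of $V^{\otimes n}$. $C_n(r,q)$ is the Birman--Murakami--Wenzl algebra: the unital complex algebra generated by invertible $g_1,\dots,g_{n-1}$ and $e_1,\dots,e_{n-1}$ with the braid relations for the $g_i$, $g_i-g_i^{-1}=(q-q^{-1})(1-e_i)$, $e_ig_i=r^{-1}e_i$, and $e_ig_{i\pm1}^{\epsilon}e_i=r^{\epsilon}e_i$ for $\epsilon\in\{1,-1\}$. At the present parameters the assignments $g_i\mapsto G_i$, $e_i\mapsto E_i$ do define a representation. The normalized BMW Markov trace is the family of linear forms $\mathrm{tr}_n$ on $C_n(r,q_{\mathrm B})$ with $\mathrm{tr}_n(1)=1$, $\mathrm{tr}_n(ab)=\mathrm{tr}_n(ba)$, $\mathrm{tr}_{n+1}(ag_n^{\pm1})=\frac{r^{\pm1}}3\mathrm{tr}_n(a)$, $\mathrm{tr}_{n+1}(ae_n)=\frac13\mathrm{tr}_n(a)$ for $a\in C_n(r,q_{\mathrm B})$. $C_n^{\mathrm{ss}}(r,q_{\mathrm B})$ is the quotient of $C_n(r,q_{\mathrm B})$ by the trace radical $\{a:\mathrm{tr}_n(ab)=0\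 \forall b\}$. A Yang--Baxter operator $R$ on $V$ is a strict localization of a compatible tower of algebras $(\mathcal D_n)$ generated by images of the braid generators if its local copies on the tensor powers $V^{\otimes n}$ of the one fixed space $V$ induce a faithful representation of $\mathcal D_n$ for every $n$; here the generator $q_{\mathrm B}^{-2}g_i$ is sent to $R_{3,i}$. *)

(* Defs.v *)
From HB Require Import structures.
From mathcomp Require Import all_boot all_order all_algebra.
From mathcomp Require Import boolp reals trigo.
From mathcomp Require Import complex.

Set Implicit Arguments.
Unset Strict Implicit.
Unset Printing Implicit Defensive.

Import Order.TTheory GRing.Theory Num.Theory.

Local Open Scope ring_scope.
Local Open Scope quotient_scope.

(* Unital associative algebras by generators and relations: formal expressions
   in the generators modulo the least congruence containing the laws of unital
   associative K-algebras and the given relations. The constant c stands for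
   c times the unit. *)
Section PresentedAlgebra.
Variables (K : fieldType) (X : Type).

Inductive alg_term : Type :=
| Gen of X
| Cst of K
| Add of alg_term & alg_term
| Mul of alg_term & alg_term.

HB.instance Definition _ := gen_eqMixin alg_term.
HB.instance Definition _ := gen_choiceMixin alg_term.

Variable rel : alg_term -> alg_term -> Prop.

Inductive alg_cong : alg_term -> alg_term -> Prop :=
| cong_rel s t : rel s t -> alg_cong s t
| cong_refl t : alg_cong t t
| cong_sym s t : alg_cong s t -> alg_cong t s
| cong_trans s t u : alg_cong s t -> alg_cong t u -> alg_cong s u
| cong_add s s' t t' :
    alg_cong s s' -> alg_cong t t' -> alg_cong (Add s t) (Add s' t')
| cong_mul s s' t t' :
    alg_cong s s' -> alg_cong t t' -> alg_cong (Mul s t) (Mul s' t')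
| cong_addA s t u : alg_cong (Add s (Add t u)) (Add (Add s t) u)
| cong_addC s t : alg_cong (Add s t) (Add t s)
| cong_add0 t : alg_cong (Add (Cst 0) t) t
| cong_addN t : alg_cong (Add (Mul (Cst (-1)) t) t) (Cst 0)
| cong_mulA s t u : alg_cong (Mul s (Mul t u)) (Mul (Mul s t) u)
| cong_mul1l t : alg_cong (Mul (Cst 1) t) t
| cong_mul1r t : alg_cong (Mul t (Cst 1)) t
| cong_mulDl s t u : alg_cong (Mul (Add s t) u) (Add (Mul s u) (Mul t u))
| cong_mulDr s t u : alg_cong (Mul s (Add t u)) (Add (Mul s t) (Mul s u))
| cong_cstD a b : alg_cong (Cst (a + b)) (Add (Cst a) (Cst b))
| cong_cstM a b : alg_cong (Cst (a * b)) (Mul (Cst a) (Cst b))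
| cong_cstC a t : alg_cong (Mul (Cst a) t) (Mul t (Cst a)).

Definition alg_congb (s t : alg_term) : bool := `[< alg_cong s t >].

Lemma alg_congb_equiv : equiv_class_of alg_congb.
Proof.
split=> [t|s t|t s u].
- exact/asboolP/cong_refl.
- by apply/asboolP/asboolP; exact: cong_sym.
- by move=> /asboolP st /asboolP tu; apply/asboolP/(cong_trans st tu).
Qed.

Canonical alg_congb_equivRel := EquivRelPack alg_congb_equiv.

Definition presented_alg := {eq_quot alg_congb}.

HB.instance Definition _ := Choice.on presented_alg.
HB.instance Definition _ := EqQuotient.on presented_alg.

Definition pclass (t : alg_term) : presented_alg := \pi t.

Lemma pclassP s t : pclass s = pclass t <-> alg_cong s t.
Proof.
split=> [/eqmodP /asboolP //|st]; exact/eqmodP/asboolP.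
Qed.

Lemma pclass_repr (x : presented_alg) : pclass (repr x) = x.
Proof. exact: reprK. Qed.

Lemma pclass_ind (P : presented_alg -> Prop) :
  (forall t, P (pclass t)) -> forall x, P x.
Proof. by move=> Pt x; rewrite -(pclass_repr x). Qed.

Lemma repr_pclass t : alg_cong (repr (pclass t)) t.
Proof. by apply/pclassP; rewrite pclass_repr. Qed.

Definition padd (x y : presented_alg) := pclass (Add (repr x) (repr y)).
Definition pmul (x y : presented_alg) := pclass (Mul (repr x) (repr y)).
Definition pcst (a : K) := pclass (Cst a).
Definition pgen (x : X) := pclass (Gen x).

Lemma pclassD s t : padd (pclass s) (pclass t) = pclass (Add s t).
Proof. by apply/pclassP; apply: cong_add; exact: repr_pclass. Qed.

Lemma pclassM s t : pmul (pclass s) (pclass t) = pclass (Mul s t).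
Proof. by apply/pclassP; apply: cong_mul; exact: repr_pclass. Qed.

Lemma paddA : associative padd.
Proof.
elim/pclass_ind=> s; elim/pclass_ind=> t; elim/pclass_ind=> u.
by rewrite !pclassD; apply/pclassP/cong_addA.
Qed.

Lemma paddC : commutative padd.
Proof.
elim/pclass_ind=> s; elim/pclass_ind=> t.
by rewrite !pclassD; apply/pclassP/cong_addC.
Qed.

Lemma padd0 : left_id (pcst 0) padd.
Proof. by elim/pclass_ind=> t; rewrite pclassD; apply/pclassP/cong_add0. Qed.

Lemma paddN : left_inverse (pcst 0) (pmul (pcst (-1))) padd.
Proof.
by elim/pclass_ind=> t; rewrite pclassM pclassD; apply/pclassP/cong_addN.
Qed.

HB.instance Definition _ :=
  GRing.isZmodule.Build presented_alg paddA paddC padd0 paddN.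

Lemma pmulA : associative pmul.
Proof.
elim/pclass_ind=> s; elim/pclass_ind=> t; elim/pclass_ind=> u.
by rewrite !pclassM; apply/pclassP/cong_mulA.
Qed.

Lemma pmul1l : left_id (pcst 1) pmul.
Proof. by elim/pclass_ind=> t; rewrite pclassM; apply/pclassP/cong_mul1l. Qed.

Lemma pmul1r : right_id (pcst 1) pmul.
Proof. by elim/pclass_ind=> t; rewrite pclassM; apply/pclassP/cong_mul1r. Qed.

Lemma pmulDl : left_distributive pmul padd.
Proof.
elim/pclass_ind=> s; elim/pclass_ind=> t; elim/pclass_ind=> u.
by rewrite !(pclassM, pclassD); apply/pclassP/cong_mulDl.
Qed.

Lemma pmulDr : right_distributive pmul padd.
Proof.
elim/pclass_ind=> s; elim/pclass_ind=> t; elim/pclass_ind=> u.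
by rewrite !(pclassM, pclassD); apply/pclassP/cong_mulDr.
Qed.

HB.instance Definition _ :=
  GRing.Zmodule_isPzRing.Build presented_alg pmulA pmul1l pmul1r pmulDl pmulDr.

Definition pscale (a : K) (x : presented_alg) := pcst a * x.

Lemma pcstD a b : pcst (a + b) = pcst a + pcst b.
Proof. by rewrite [RHS]pclassD; apply/pclassP/cong_cstD. Qed.

Lemma pcstM a b : pcst (a * b) = pcst a * pcst b.
Proof. by rewrite [RHS]pclassM; apply/pclassP/cong_cstM. Qed.

Lemma pcstC a (x : presented_alg) : pcst a * x = x * pcst a.
Proof.
elim/pclass_ind: x => t.
by rewrite [LHS]pclassM [RHS]pclassM; apply/pclassP/cong_cstC.
Qed.

Lemma pscaleA a b x : pscale a (pscale b x) = pscale (a * b) x.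
Proof. by rewrite /pscale mulrA pcstM. Qed.

Lemma pscale1 : left_id 1 pscale.
Proof. exact: mul1r. Qed.

Lemma pscaleDr : right_distributive pscale +%R.
Proof. by move=> a x y; rewrite /pscale mulrDr. Qed.

Lemma pscaleDl x : {morph pscale^~ x : a b / a + b}.
Proof. by move=> a b; rewrite /pscale pcstD mulrDl. Qed.

HB.instance Definition _ :=
  GRing.Zmodule_isLmodule.Build K presented_alg
    pscaleA pscale1 pscaleDr pscaleDl.

Lemma pscaleAl (a : K) (x y : presented_alg) : a *: (x * y) = (a *: x) * y.
Proof. exact: mulrA. Qed.

Lemma pscaleAr (a : K) (x y : presented_alg) : a *: (x * y) = x * (a *: y).
Proof. by rewrite /GRing.scale/= /pscale mulrA pcstC -mulrA. Qed.

Fact pcst_is_nmod_morphism : nmod_morphism pcst.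
Proof. by split=> [|a b] //; exact: pcstD. Qed.

Fact pcst_is_monoid_morphism : monoid_morphism pcst.
Proof. by split=> [|a b] //; exact: pcstM. Qed.

HB.instance Definition _ :=
  GRing.isNmodMorphism.Build K presented_alg pcst pcst_is_nmod_morphism.
HB.instance Definition _ :=
  GRing.isMonoidMorphism.Build K presented_alg pcst pcst_is_monoid_morphism.

End PresentedAlgebra.

Arguments Gen {K X}.
Arguments Cst {K X}.
Arguments Add {K X}.
Arguments Mul {K X}.

(* Evaluation of formal expressions; the constants go through iota so that a
   target without a canonical algebra structure (such as 'M_n) is allowed. *)
Section Evaluation.
Variables (K : fieldType) (X : Type) (B : pzRingType).
Variables (iota : {rmorphism K -> B}) (f : X -> B).

Fixpoint alg_eval (t : alg_term K X) : B :=
  match t with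
  | Gen x => f x
  | Cst c => iota c
  | Add s t => alg_eval s + alg_eval t
  | Mul s t => alg_eval s * alg_eval t
  end.

Hypothesis iotaC : forall a b, iota a * b = b * iota a.
Variable rel : alg_term K X -> alg_term K X -> Prop.
Hypothesis relP : forall s t, rel s t -> alg_eval s = alg_eval t.

Lemma alg_eval_cong s t : alg_cong rel s t -> alg_eval s = alg_eval t.
Proof.
elim=> {s t} /=.
- exact: relP.
- by [].
- by move=> s t _ ->.
- by move=> s t u _ -> _ ->.
- by move=> s s' t t' _ -> _ ->.
- by move=> s s' t t' _ -> _ ->.
- by move=> s t u; rewrite addrA.
- by move=> s t; rewrite addrC.
- by move=> t; rewrite rmorph0 add0r.
- by move=> t; rewrite rmorphN1 mulN1r addNr rmorph0.
- by move=> s t u; rewrite mulrA.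
- by move=> t; rewrite rmorph1 mul1r.
- by move=> t; rewrite rmorph1 mulr1.
- by move=> s t u; rewrite mulrDl.
- by move=> s t u; rewrite mulrDr.
- by move=> a b; rewrite rmorphD.
- by move=> a b; rewrite rmorphM.
- by move=> a t; rewrite iotaC.
Qed.

Definition presented_lift (x : presented_alg rel) : B := alg_eval (repr x).

Lemma presented_liftE t : presented_lift (pclass rel t) = alg_eval t.
Proof. exact/alg_eval_cong/repr_pclass. Qed.

Lemma presented_lift_gen x : presented_lift (pgen rel x) = f x.
Proof. exact: presented_liftE. Qed.

Lemma presented_liftD : {morph presented_lift : x y / x + y}.
Proof.
elim/pclass_ind=> s; elim/pclass_ind=> t.
by rewrite [_ + _]pclassD !presented_liftE.
Qed.

Lemma presented_liftM : {morph presented_lift : x y / x * y}.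
Proof.
elim/pclass_ind=> s; elim/pclass_ind=> t.
by rewrite [_ * _]pclassM !presented_liftE.
Qed.

Lemma presented_lift1 : presented_lift 1 = 1.
Proof. by rewrite presented_liftE /= rmorph1. Qed.

Lemma presented_liftZ a x : presented_lift (a *: x) = iota a * presented_lift x.
Proof. by rewrite presented_liftM presented_liftE. Qed.

End Evaluation.

Fixpoint alg_rename (K : fieldType) (X Y : Type) (h : X -> Y)
    (t : alg_term K X) : alg_term K Y :=
  match t with
  | Gen x => Gen (h x)
  | Cst c => Cst c
  | Add s t => Add (alg_rename h s) (alg_rename h t)
  | Mul s t => Mul (alg_rename h s) (alg_rename h t)
  end.

Lemma alg_eval_pgen (K : fieldType) (X Y : Type) (h : X -> Y)
    (rel : alg_term K Y -> alg_term K Y -> Prop) (t : alg_term K X) :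
  alg_eval (pcst rel) (fun x => pgen rel (h x)) t =
  pclass rel (alg_rename h t).
Proof.
elim: t => //= s -> t ->; first exact: pclassD.
exact: pclassM.
Qed.

(* The Birman-Murakami-Wenzl algebra on n strands, with generators indexed by
   'I_n.-1; for n = 0, 1 there are no generators. *)
Section BMW.
Variables (K : fieldType) (r q : K).

Inductive bmw_gen (n : nat) : Type :=
| BG of 'I_n.-1
| BGinv of 'I_n.-1
| BE of 'I_n.-1.

Definition adjacent (m : nat) (i j : 'I_m) : bool :=
  (i.+1 == j :> nat) || (j.+1 == i :> nat).

Section Relations.
Variable n : nat.
Local Notation term := (alg_term K (bmw_gen n)).
Local Notation g i := (Gen (BG i) : term).
Local Notation gi i := (Gen (BGinv i) : term).
Local Notation e i := (Gen (BE i) : term).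
Local Notation sub s t := (Add s (Mul (Cst (-1)) t) : term).

Inductive bmw_rel : term -> term -> Prop :=
| bmwr_gV i : bmw_rel (Mul (g i) (gi i)) (Cst 1)
| bmwr_Vg i : bmw_rel (Mul (gi i) (g i)) (Cst 1)
| bmwr_far i j : i != j -> ~~ adjacent i j ->
    bmw_rel (Mul (g i) (g j)) (Mul (g j) (g i))
| bmwr_braid i j : adjacent i j ->
    bmw_rel (Mul (Mul (g i) (g j)) (g i)) (Mul (Mul (g j) (g i)) (g j))
| bmwr_skein i :
    bmw_rel (sub (g i) (gi i)) (Mul (Cst (q - q^-1)) (sub (Cst 1) (e i)))
| bmwr_twist i : bmw_rel (Mul (e i) (g i)) (Mul (Cst r^-1) (e i))
| bmwr_ege i j : adjacent i j ->
    bmw_rel (Mul (Mul (e i) (g j)) (e i)) (Mul (Cst r) (e i))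
| bmwr_egVe i j : adjacent i j ->
    bmw_rel (Mul (Mul (e i) (gi j)) (e i)) (Mul (Cst r^-1) (e i)).

(* The character g_i |-> q, e_i |-> 0 shows that the algebra is nonzero; it is
   adjusted at q = 0, where q^-1 = 0 as well. *)
Let u : K := if q == 0 then 1 else q.
Let chi (x : bmw_gen n) : K :=
  match x with BG _ => u | BGinv _ => u^-1 | BE _ => 0 end.

Lemma bmw_chi s t : bmw_rel s t ->
  alg_eval (idfun : {rmorphism K -> K}) chi s =
  alg_eval (idfun : {rmorphism K -> K}) chi t.
Proof.
have u0 : u != 0 by rewrite /u; case: (eqVneq q 0) => // _; rewrite oner_eq0.
case=> {s t} /= *; rewrite ?mul0r ?mulr0 ?divff ?mulVf //.
rewrite mulN1r ?mulr0 addr0 mulr1 /u; case: (eqVneq q 0) => [->|//].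
by rewrite invr0 invr1 !subrr.
Qed.

End Relations.

Definition bmw (n : nat) := presented_alg (@bmw_rel n).

HB.instance Definition _ (n : nat) := GRing.Lmodule.on (bmw n).
HB.instance Definition _ (n : nat) := GRing.PzRing.on (bmw n).

Lemma bmw_nontrivial (n : nat) : 1 != 0 :> bmw n.
Proof.
apply/eqP => /pclassP /(alg_eval_cong (fun a b => mulrC _ _) (@bmw_chi n)) /=.
by move/eqP; rewrite oner_eq0.
Qed.

HB.instance Definition _ (n : nat) :=
  GRing.PzSemiRing_isNonZero.Build (bmw n) (bmw_nontrivial n).
HB.instance Definition _ (n : nat) :=
  GRing.LSemiModule_isLSemiAlgebra.Build K (bmw n) (@pscaleAl K _ (@bmw_rel n)).
HB.instance Definition _ (n : nat) :=
  GRing.LSemiAlgebra_isSemiAlgebra.Build K (bmw n) (@pscaleAr K _ (@bmw_rel n)).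

Definition bmw_g (n : nat) (i : 'I_n.-1) : bmw n := pgen (@bmw_rel n) (BG i).
Definition bmw_gV (n : nat) (i : 'I_n.-1) : bmw n := pgen (@bmw_rel n) (BGinv i).
Definition bmw_e (n : nat) (i : 'I_n.-1) : bmw n := pgen (@bmw_rel n) (BE i).

End BMW.

(* The natural map C_n -> C_(n+1) adding a strand on the right. *)
Section Inclusion.
Variables (K : fieldType) (r q : K) (n : nat).

Definition bmw_widen (x : bmw_gen n) : bmw_gen n.+1 :=
  let w := widen_ord (leq_pred n) in
  match x with
  | BG i => @BG n.+1 (w i)
  | BGinv i => @BGinv n.+1 (w i)
  | BE i => @BE n.+1 (w i)
  end.

Let f (x : bmw_gen n) : bmw r q n.+1 := pgen (@bmw_rel K r q n.+1) (bmw_widen x).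
Let iota := pcst (@bmw_rel K r q n.+1).

Lemma bmw_widen_rel s t : bmw_rel r q s t ->
  alg_eval iota f s = alg_eval iota f t.
Proof.
rewrite !alg_eval_pgen => st; apply/pclassP/cong_rel; case: st => {s t} *.
all: by [apply: bmwr_gV | apply: bmwr_Vg
  | apply: bmwr_far | apply: bmwr_braid | apply: bmwr_skein
  | apply: bmwr_twist | apply: bmwr_ege | apply: bmwr_egVe].
Qed.

Definition bmw_incl : bmw r q n -> bmw r q n.+1 :=
  presented_lift iota f (rel := @bmw_rel K r q n).

Fact bmw_incl_is_nmod_morphism : nmod_morphism bmw_incl.
Proof.
split; first by rewrite [LHS](presented_liftE (@pcstC _ _ _) bmw_widen_rel).
exact: (presented_liftD (@pcstC _ _ _) bmw_widen_rel).
Qed.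

Fact bmw_incl_is_monoid_morphism : monoid_morphism bmw_incl.
Proof.
split; first exact: (presented_lift1 (@pcstC _ _ _) bmw_widen_rel).
exact: (presented_liftM (@pcstC _ _ _) bmw_widen_rel).
Qed.

Fact bmw_incl_is_scalable : scalable bmw_incl.
Proof. exact: (presented_liftZ (@pcstC _ _ _) bmw_widen_rel). Qed.

HB.instance Definition _ :=
  GRing.isNmodMorphism.Build (bmw r q n) (bmw r q n.+1) bmw_incl
    bmw_incl_is_nmod_morphism.
HB.instance Definition _ :=
  GRing.isMonoidMorphism.Build (bmw r q n) (bmw r q n.+1) bmw_incl
    bmw_incl_is_monoid_morphism.
HB.instance Definition _ :=
  GRing.isScalable.Build K (bmw r q n) (bmw r q n.+1) _ bmw_incl
    bmw_incl_is_scalable.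

End Inclusion.

(* The quotient of an algebra by the radical of a normalized trace form. *)
Section TraceQuotient.
Variables (K : fieldType) (A : algType K).

Record normalized_trace := NormalizedTrace {
  ntrace :> {scalar A};
  ntrace1 : ntrace 1 = 1;
  ntraceC : forall a b, ntrace (a * b) = ntrace (b * a)
}.

Variable tr : normalized_trace.

Definition trace_radical (a : A) : Prop := forall b, tr (a * b) = 0.

Lemma trace_radicalM x a y : trace_radical a -> trace_radical (x * a * y).
Proof. by move=> ra b; rewrite -!mulrA ntraceC -!mulrA ra. Qed.

Lemma trace_radicalB a b :
  trace_radical a -> trace_radical b -> trace_radical (a - b).
Proof. by move=> ra rb c; rewrite mulrBl raddfB /= ra rb subrr. Qed.

Definition trad_cong (a b : A) : bool := `[< trace_radical (a - b) >].

Lemma trad_cong_equiv : equiv_class_of trad_cong.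
Proof.
split=> [a|a b|b a c].
- by apply/asboolP=> c; rewrite subrr mul0r raddf0.
- by apply/asboolP/asboolP=> rab c; rewrite -opprB mulNr raddfN /= rab oppr0.
- move=> /asboolP rab /asboolP rbc; apply/asboolP=> d.
  by rewrite -(subrK b a) -addrA mulrDl raddfD /= rab rbc addr0.
Qed.

Canonical trad_cong_equivRel := EquivRelPack trad_cong_equiv.

Definition trace_quotient := {eq_quot trad_cong}.

HB.instance Definition _ := Choice.on trace_quotient.
HB.instance Definition _ := EqQuotient.on trace_quotient.

Definition tclass (a : A) : trace_quotient := \pi a.

Lemma tclassP a b : tclass a = tclass b <-> trace_radical (a - b).
Proof. by split=> [/eqmodP /asboolP //|rab]; exact/eqmodP/asboolP. Qed.

Lemma tclass_repr (x : trace_quotient) : tclass (repr x) = x.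
Proof. exact: reprK. Qed.

Lemma tclass_ind (P : trace_quotient -> Prop) :
  (forall a, P (tclass a)) -> forall x, P x.
Proof. by move=> Pa x; rewrite -(tclass_repr x). Qed.

Lemma repr_tclass a : trace_radical (repr (tclass a) - a).
Proof. by apply/tclassP; rewrite tclass_repr. Qed.

Definition tqadd (x y : trace_quotient) := tclass (repr x + repr y).
Definition tqopp (x : trace_quotient) := tclass (- repr x).
Definition tqmul (x y : trace_quotient) := tclass (repr x * repr y).
Definition tqscale (c : K) (x : trace_quotient) := tclass (c *: repr x).

Lemma tqaddE a b : tqadd (tclass a) (tclass b) = tclass (a + b).
Proof.
apply/tclassP=> c; rewrite opprD addrACA mulrDl raddfD /=.
by rewrite !repr_tclass addr0.
Qed.

Lemma tqoppE a : tqopp (tclass a) = tclass (- a).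
Proof. by apply/tclassP=> c; rewrite -opprD mulNr raddfN /= repr_tclass oppr0. Qed.

Lemma tqmulE a b : tqmul (tclass a) (tclass b) = tclass (a * b).
Proof.
apply/tclassP=> c; set a' := repr _; set b' := repr _.
have -> : a' * b' - a * b = 1 * (a' - a) * b' - a * (b - b') * 1.
  by rewrite mul1r mulr1 mulrBl mulrBr opprB addrA subrK.
apply: trace_radicalB; apply: trace_radicalM; first exact: repr_tclass.
by move=> d; rewrite -opprB mulNr raddfN /= repr_tclass oppr0.
Qed.

Lemma tqscaleE c a : tqscale c (tclass a) = tclass (c *: a).
Proof.
apply/tclassP=> d; rewrite -scalerBr -scalerAl linearZ /= repr_tclass.
exact: mulr0.
Qed.

Let tqE := (tqaddE, tqoppE, tqmulE, tqscaleE).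

Lemma tqaddA : associative tqadd.
Proof.
elim/tclass_ind=> a; elim/tclass_ind=> b; elim/tclass_ind=> c.
by rewrite !tqE addrA.
Qed.

Lemma tqaddC : commutative tqadd.
Proof. by elim/tclass_ind=> a; elim/tclass_ind=> b; rewrite !tqE addrC. Qed.

Lemma tqadd0 : left_id (tclass 0) tqadd.
Proof. by elim/tclass_ind=> a; rewrite !tqE add0r. Qed.

Lemma tqaddN : left_inverse (tclass 0) tqopp tqadd.
Proof. by elim/tclass_ind=> a; rewrite !tqE addNr. Qed.

HB.instance Definition _ :=
  GRing.isZmodule.Build trace_quotient tqaddA tqaddC tqadd0 tqaddN.

Lemma tqmulA : associative tqmul.
Proof.
elim/tclass_ind=> a; elim/tclass_ind=> b; elim/tclass_ind=> c.
by rewrite !tqE mulrA.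
Qed.

Lemma tqmul1l : left_id (tclass 1) tqmul.
Proof. by elim/tclass_ind=> a; rewrite !tqE mul1r. Qed.

Lemma tqmul1r : right_id (tclass 1) tqmul.
Proof. by elim/tclass_ind=> a; rewrite !tqE mulr1. Qed.

Lemma tqmulDl : left_distributive tqmul tqadd.
Proof.
elim/tclass_ind=> a; elim/tclass_ind=> b; elim/tclass_ind=> c.
by rewrite !tqE mulrDl.
Qed.

Lemma tqmulDr : right_distributive tqmul tqadd.
Proof.
elim/tclass_ind=> a; elim/tclass_ind=> b; elim/tclass_ind=> c.
by rewrite !tqE mulrDr.
Qed.

Lemma tq_nontrivial : tclass 1 != tclass 0.
Proof.
apply/eqP=> /tclassP /(_ 1) /eqP.
by rewrite subr0 mulr1 ntrace1 oner_eq0.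
Qed.

HB.instance Definition _ :=
  GRing.Zmodule_isNzRing.Build trace_quotient
    tqmulA tqmul1l tqmul1r tqmulDl tqmulDr tq_nontrivial.

Lemma tqscaleA c d x : tqscale c (tqscale d x) = tqscale (c * d) x.
Proof. by elim/tclass_ind: x => a; rewrite !tqE scalerA. Qed.

Lemma tqscale1 : left_id 1 tqscale.
Proof. by elim/tclass_ind=> a; rewrite !tqE scale1r. Qed.

Lemma tqscaleDr : right_distributive tqscale +%R.
Proof.
move=> c; elim/tclass_ind=> a; elim/tclass_ind=> b.
by rewrite [in LHS]/GRing.add [in RHS]/GRing.add /= !tqE scalerDr.
Qed.

Lemma tqscaleDl x : {morph tqscale^~ x : c d / c + d}.
Proof.
elim/tclass_ind: x => a c d.
by rewrite [in RHS]/GRing.add /= !tqE scalerDl.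
Qed.

HB.instance Definition _ :=
  GRing.Zmodule_isLmodule.Build K trace_quotient
    tqscaleA tqscale1 tqscaleDr tqscaleDl.

Lemma tqscaleAl (c : K) (x y : trace_quotient) : c *: (x * y) = (c *: x) * y.
Proof.
elim/tclass_ind: x => a; elim/tclass_ind: y => b.
by rewrite /GRing.scale /GRing.mul /= !tqE scalerAl.
Qed.

Lemma tqscaleAr (c : K) (x y : trace_quotient) : c *: (x * y) = x * (c *: y).
Proof.
elim/tclass_ind: x => a; elim/tclass_ind: y => b.
by rewrite /GRing.scale /GRing.mul /= !tqE scalerAr.
Qed.

HB.instance Definition _ :=
  GRing.LSemiModule_isLSemiAlgebra.Build K trace_quotient tqscaleAl.
HB.instance Definition _ :=
  GRing.LSemiAlgebra_isSemiAlgebra.Build K trace_quotient tqscaleAr.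

Fact tclass_is_nmod_morphism : nmod_morphism tclass.
Proof. by split=> [|a b] //; rewrite [RHS]tqaddE. Qed.

Fact tclass_is_monoid_morphism : monoid_morphism tclass.
Proof. by split=> [|a b] //; rewrite [RHS]tqmulE. Qed.

Fact tclass_is_scalable : scalable tclass.
Proof. by move=> c a; rewrite [RHS]tqscaleE. Qed.

HB.instance Definition _ :=
  GRing.isNmodMorphism.Build A trace_quotient tclass tclass_is_nmod_morphism.
HB.instance Definition _ :=
  GRing.isMonoidMorphism.Build A trace_quotient tclass
    tclass_is_monoid_morphism.
HB.instance Definition _ :=
  GRing.isScalable.Build K A trace_quotient _ tclass tclass_is_scalable.

End TraceQuotient.

(* Operators on the space with basis (e_x), x : T, are matrices acting on
   column vectors, rows and columns being numbered by the enumeration of T. *)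
Notation endmx K T := 'M[K]_#|{: T}|.

Section TensorPowers.
Variables (K : fieldType).

(* The operator e_y |-> \sum_x f x y *: e_x, and its matrix coefficients. *)
Definition op_of (T : finType) (f : T -> T -> K) : endmx K T :=
  \matrix_(a, b) f (enum_val a) (enum_val b).

Definition op_coef (T : finType) (M : endmx K T) (x y : T) : K :=
  M (enum_rank x) (enum_rank y).

Variable T : finType.

Definition fst_factor (n : nat) (i : 'I_n.-1) : 'I_n :=
  widen_ord (leq_pred n) i.

Fact snd_factor_subproof (n : nat) (i : 'I_n.-1) : (i.+1 < n)%N.
Proof. by rewrite -ltn_predRL ltn_ord. Qed.

Definition snd_factor (n : nat) (i : 'I_n.-1) : 'I_n :=
  Ordinal (snd_factor_subproof i).

(* The copy of an operator on V (x) V, whose basis is indexed by T * T, on the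
   tensor factors i, i+1 (counted from 0) of the n-th tensor power of V, whose
   basis vector e_(x 0) (x) ... (x) e_(x (n-1)) is indexed by x. *)
Definition local_copy (n : nat) (M : endmx K (T * T)) (i : 'I_n.-1) :
    endmx K {ffun 'I_n -> T} :=
  let i1 := fst_factor i in let i2 := snd_factor i in
  op_of (fun x y : {ffun 'I_n -> T} =>
    op_coef M (x i1, x i2) (y i1, y i2) *
    [forall k, (k != i1) && (k != i2) ==> (x k == y k)]%:R).

Definition yang_baxter_operator (M : endmx K (T * T)) : Prop :=
  let M1 := local_copy (n := 3) M ord0 in
  let M2 := local_copy (n := 3) M ord_max in
  M \in unitmx /\ M1 *m M2 *m M1 = M2 *m M1 *m M2.

End TensorPowers.

Section StrictLocalization.
Variable K : fieldType.

Definition two_sided_inverse (A : pzRingType) (x y : A) : Prop :=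
  x * y = 1 /\ y * x = 1.

Definition braid_relations (A : pzRingType) (n : nat) (b : 'I_n.-1 -> A) :
    Prop :=
  (forall i j, i != j -> ~~ adjacent i j -> b i * b j = b j * b i) /\
  (forall i j, adjacent i j -> b i * b j * b i = b j * b i * b j).

Inductive generated_by (A : algType K) (S : A -> Prop) : A -> Prop :=
| generated_scalar c : generated_by S c%:A
| generated_gen x : S x -> generated_by S x
| generated_add x y :
    generated_by S x -> generated_by S y -> generated_by S (x + y)
| generated_mul x y :
    generated_by S x -> generated_by S y -> generated_by S (x * y).

(* D n is a quotient of the group algebra of the braid group on n strands, with
   b n i the image of the i-th braid generator, and adding a strand induces a
   homomorphism D n -> D (n+1). *)
Definition braid_tower (D : nat -> algType K) (b : forall n, 'I_n.-1 -> D n) :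
    Prop :=
  forall n : nat,
  [/\ braid_relations (b n),
      forall i, exists y, two_sided_inverse (b n i) y,
      forall x, generated_by
        (fun y => exists i, y = b n i \/ two_sided_inverse (b n i) y) x
    & exists f : {lrmorphism D n -> D n.+1},
        forall i : 'I_n.-1, f (b n i) = b n.+1 (widen_ord (leq_pred n) i)].

Definition strict_localization (T : finType) (M : endmx K (T * T))
    (D : nat -> algType K) (b : forall n, 'I_n.-1 -> D n) : Prop :=
  [/\ yang_baxter_operator M,
      braid_tower b
    & forall n : nat, exists phi : {lrmorphism D n -> endmx K {ffun 'I_n -> T}},
        (forall i, phi (b n i) = local_copy M i) /\ injective phi].

End StrictLocalization.

Section AtSixthRoot.
Variable R : realType.

(* expi t is e^(i t). *)
Definition expi (t : R) : R[i] := (cos t +i* sin t)%C.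

Definition omega3 : R[i] := expi (2 * pi / 3).
Definition qB : R[i] := expi (pi / 6).
Definition rB : R[i] := qB ^+ 3.

(* The exponent is read as a residue in {0, 1, 2}; omega3 ^+ 3 = 1. *)
Definition omega3_pow (a : 'F_3) : R[i] := omega3 ^+ a.

Definition R3 : endmx R[i] ('F_3 * 'F_3) :=
  op_of (fun x' xy : 'F_3 * 'F_3 =>
    let: (x, y) := xy in
    ((Num.sqrt 3)^-1)%:C%C *
    \sum_(t : 'F_3 | x' == (x + t, y - t))
      omega3_pow (t ^+ 2 + t - (x + y) ^+ 2 + (x + y))).

Definition G3 : endmx R[i] ('F_3 * 'F_3) := qB ^+ 2 *: R3.
Definition E3 : endmx R[i] ('F_3 * 'F_3) :=
  1%:M - (qB - qB^-1)^-1 *: (G3 - invmx G3).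

Definition bmwB (n : nat) : algType R[i] := bmw rB qB n.

(* For n + 2 strands the last generator has index n = ord_max. *)
Definition markov_trace (tr : forall n, normalized_trace (bmwB n)) : Prop :=
  forall (n : nat) (a : bmwB n.+1),
  [/\ tr n.+2 (bmw_incl a * bmw_g rB qB (n := n.+2) ord_max) =
        rB / 3 * tr n.+1 a,
      tr n.+2 (bmw_incl a * bmw_gV rB qB (n := n.+2) ord_max) =
        rB^-1 / 3 * tr n.+1 a
    & tr n.+2 (bmw_incl a * bmw_e rB qB (n := n.+2) ord_max) =
        3^-1 * tr n.+1 a].

Definition bmw_ss (tr : forall n, normalized_trace (bmwB n)) (n : nat) :
    algType R[i] :=
  trace_quotient (tr n).

Definition bmw_ss_braid (tr : forall n, normalized_trace (bmwB n)) (n : nat)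
    (i : 'I_n.-1) : bmw_ss tr n :=
  qB ^- 2 *: tclass (tr n) (bmw_g rB qB i).

End AtSixthRoot.

(* Main.v *)
(* With w = e^(2 pi i/3), the commuting operators U = w T, where
   T (e_x (x) e_y) = e_(x+1) (x) e_(y-1), and P, multiplication by w^(1+x+y), on
   V (x) V have cube 1. Writing Q_c(X) = 1 + c X + c X^2, one has
     G = (i/3) Q_w(P) Q_w(U),  G^-1 = (-i/3) Q_(w^2)(P) Q_(w^2)(U),
     E = (1/3) Q_1(P) Q_1(U).
   The local copies satisfy U_i P_(i+1) = w P_(i+1) U_i and
   P_i U_(i+1) = w U_(i+1) P_i and commute otherwise, so that words in two
   neighbouring sites factor over the pairs (U_i, P_(i+1)) and (P_i, U_(i+1)).
   The BMW relations thus follow from identities for a single pair with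
   X Y = w Y X; for the braid relation, Q_w(X) Q_w(Y) conjugates X to Y^2.

   The normalized matrix trace is a Markov trace, since a product P^s U^t at the
   last two sites is traceless against operators on the other sites unless
   s = t = 0. Since C_(n+1) is spanned by C_n and the C_n x C_n with x = g_n or
   x = e_n, it is the only Markov trace with these parameters. Finally, U and P
   are unitary, so the image of the representation is closed under adjoints, and
   by positivity of tr(A A^* ) the trace radical is the kernel of the
   representation. *)

Require Import Defs.
From HB Require Import structures.
From mathcomp Require Import all_boot all_order all_algebra.
From mathcomp Require Import boolp reals trigo.
From mathcomp Require Import complex.
From mathcomp Require Import ring lra.

Set Implicit Arguments.
Unset Strict Implicit.
Unset Printing Implicit Defensive.

Import Order.TTheory GRing.Theory Num.Theory.

Local Open Scope ring_scope.

(** * Quadratic expressions in elements of order three *)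

Section Quad.
Variables (K : fieldType) (B : pzRingType) (iota : {rmorphism K -> B}).
Hypothesis iotaC : forall a b, iota a * b = b * iota a.
Implicit Types (a b c : K) (x y z : B).

(** When x^3 = 1 this is the image of a general element of the group algebra of Z/3. Scalars enter
    through the central morphism [iota], later [scalar_mx]. *)
Definition tri a b c x : B := iota a + iota b * x + iota c * x ^+ 2.
Definition quad a := tri 1 a a.

Lemma iotaA a b x : iota a * (iota b * x) = iota (a * b) * x.
Proof. by rewrite mulrA rmorphM. Qed.

Lemma iotaCA a x y : x * (iota a * y) = iota a * (x * y).
Proof. by rewrite mulrA -iotaC mulrA. Qed.

Lemma iotaM a b x y : iota a * x * (iota b * y) = iota (a * b) * (x * y).
Proof. by rewrite -mulrA iotaCA iotaA. Qed.

Lemma triM a b c a' b' c' x : x ^+ 3 = 1 ->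
  tri a b c x * tri a' b' c' x =
  tri (a * a' + b * c' + c * b') (a * b' + b * a' + c * c')
      (a * c' + b * b' + c * a') x.
Proof.
move=> x3; have x4 : x ^+ 4 = x by rewrite exprS x3 mulr1.
rewrite /tri !mulrDl !mulrDr !iotaM -!rmorphM !iotaA -!expr2 -!exprM -!exprS
  -!exprSr.
rewrite -!(iotaC a') !iotaA x3 x4 !mulr1 !rmorphD !mulrDl.
rewrite !(mulrC a').
(* The nine products are grouped by exponent modulo 3, after [x ^+ 3] and [x ^+ 4] have been
   reduced. *)
by rewrite [LHS](AC (3*3*3) ((1*6*8)*(2*4*9)*(3*5*7))).
Qed.

Lemma tri_scale a b c d x :
  iota a * tri b c d x = tri (a * b) (a * c) (a * d) x.
Proof. by rewrite /tri !mulrDr !iotaA -rmorphM. Qed.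

Lemma tri_conj w a b c x y : x * y = iota w * (y * x) ->
  tri a b c x * y = y * tri a (b * w) (c * w ^+ 2) x.
Proof.
move=> xy; have xxy : x ^+ 2 * y = iota (w ^+ 2) * (y * x ^+ 2).
  by rewrite !expr2 -mulrA xy iotaCA (mulrA x) xy -mulrA iotaA -(mulrA y).
rewrite /tri !mulrDl !mulrDr -!(mulrA (iota _)) xy xxy !iotaA !iotaCA.
by rewrite iotaC.
Qed.

Lemma tri_comm a b c x y : x * y = y * x -> tri a b c x * y = y * tri a b c x.
Proof.
move=> xy; rewrite (@tri_conj 1); first by rewrite expr1n !mulr1.
by rewrite rmorph1 mul1r.
Qed.

Section CubeRoot.
Variable w : K.
Hypothesis w_root : 1 + w + w ^+ 2 = 0.

Lemma cube_root_cube : w ^+ 3 = 1.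
Proof.
apply/eqP; rewrite -subr_eq0; apply/eqP.
have -> : w ^+ 3 - 1 = (w - 1) * (1 + w + w ^+ 2) by ring.
by rewrite w_root mulr0.
Qed.

Lemma cube_root_sqr : w ^+ 2 = - 1 - w.
Proof. by apply/eqP; rewrite -subr_eq0 -w_root; apply/eqP; ring. Qed.

Lemma tri0 x : tri 0 0 0 x = 0.
Proof. by rewrite /tri !rmorph0 !mul0r !addr0. Qed.

(** Moving [y] to the left turns the first factor into 1 + w x + w^2 x^2; every coefficient of its
    product with 1 + x + x^2 is 1 + w + w^2 = 0. *)
Lemma quad_kill x y : x ^+ 3 = 1 -> x * y = iota w * (y * x) ->
  quad 1 x * y * quad 1 x = 0.
Proof.
move=> x3 xy; rewrite (tri_conj _ _ _ xy) -mulrA triM // cube_root_sqr.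
by rewrite (_ : tri _ _ _ _ = 0) ?mulr0 // -(tri0 x); congr tri; ring.
Qed.

(** The coefficients 1, w, w are w^(k^2). Moving [y] rescales x^k by w^k, which, after completing
    the square, amounts to multiplying by w^2 x. *)
Lemma quad_shift x y : x ^+ 3 = 1 -> x * y = iota w * (y * x) ->
  quad w x * y = iota (w ^+ 2) * (y * x * quad w x).
Proof.
move=> x3 xy; rewrite (tri_conj _ _ _ xy) -mulrA -iotaCA; congr (_ * _).
have xE : x = tri 0 1 0 x by rewrite /tri rmorph0 rmorph1 mul0r mul1r add0r
  addr0.
rewrite {2}xE triM // tri_scale !mul0r !mulr1 !mul1r !add0r !addr0.
by rewrite -expr2 -exprSr -exprS cube_root_cube mulr1.
Qed.

Lemma tri_intertwine a b c x z m : m * x = z * m ->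
  m * tri a b c x = tri a b c z * m.
Proof.
move=> mx; have mxx : m * x ^+ 2 = z ^+ 2 * m.
  by rewrite !expr2 mulrA mx -mulrA mx mulrA.
by rewrite /tri !mulrDr !mulrDl !iotaCA mx mxx -iotaC -!(mulrA (iota _)).
Qed.

(** The coefficients of y and y^2 agree, so [quad a] is invariant under y -> y^2 = y^-1. *)
Lemma quad_sqr a y : y ^+ 3 = 1 -> quad a (y ^+ 2) = quad a y.
Proof.
by move=> y3; rewrite /quad /tri -exprM (exprSr y 3) y3 mul1r -!addrA (addrC
  (_ * y)).
Qed.

(** Put A = [quad w x] and B = [quad w y]. From A B x = y^2 A B it follows that A B carries
    [quad w x] to [quad w] of y^2, which is B again; hence A B A = B A B. *)
Lemma quad_braid x y : x ^+ 3 = 1 -> y ^+ 3 = 1 -> x * y = iota w * (y * x) ->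
  quad w x * quad w y * quad w x = quad w y * quad w x * quad w y.
Proof.
move=> x3 y3 xy.
have yx : y * x = iota (w ^+ 2) * (x * y) by rewrite xy iotaA -exprSr
  cube_root_cube rmorph1 mul1r.
have xyy : x * y ^+ 2 = iota (w ^+ 2) * (y ^+ 2 * x).
  by rewrite !expr2 mulrA xy -2!mulrA xy iotaCA iotaA (mulrA y).
have yyE : y ^+ 2 = tri 0 0 1 y by rewrite /tri !rmorph0 rmorph1 mul0r mul1r
  !add0r.
(* The square is completed as in [quad_shift], but the commutation factor is now w^2, so y^2 appears
   instead of a first power. *)
have Ax : quad w y * x = iota (w ^+ 2) * (x * y ^+ 2 * quad w y).
  rewrite (tri_conj _ _ _ yx) -mulrA -iotaCA; congr (_ * _).
  rewrite yyE triM // tri_scale !mul0r !mulr1 !mul1r !add0r.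
  by rewrite -exprM -!exprS -exprSr cube_root_cube mulr1 (exprD w 3 2)
    cube_root_cube mul1r.
have xyyE : x * y ^+ 2 * x ^+ 2 = iota (w ^+ 2) * y ^+ 2.
  by rewrite xyy -mulrA -mulrA -exprS x3 mulr1.
have yxyx : y * x * (y * x) = iota w * (y ^+ 2 * x ^+ 2).
  rewrite mulrA -(mulrA y x y) xy (iotaCA _ y) -(mulrA (iota w)) !expr2.
  by congr (_ * _); rewrite !mulrA.
(* [quad_shift] is used once for each factor of y^2. *)
have Bxx : quad w x * y ^+ 2 = iota (w ^+ 2) * (y ^+ 2 * x ^+ 2 * quad w x).
  rewrite {1}expr2 mulrA (quad_shift x3 xy) -(mulrA (iota _)) -(mulrA (y * x)).
  rewrite (quad_shift x3 xy) (iotaCA _ (y * x)) iotaA (mulrA (y * x)) yxyx.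
  by rewrite -(mulrA (iota w)) iotaA -exprD -exprSr (exprD w 3 2)
    cube_root_cube mul1r.
have xA : x * quad w x = quad w x * x by rewrite tri_comm.
have ABx : quad w x * quad w y * x = y ^+ 2 * (quad w x * quad w y).
  rewrite -mulrA Ax (iotaCA _ (quad w x)) (mulrA (quad w x)) (mulrA (quad w x)).
  rewrite -xA -(mulrA x) Bxx (iotaCA _ x) -(mulrA (iota _)) iotaA.
  have -> : x * (y ^+ 2 * x ^+ 2 * quad w x) * quad w y =
      iota (w ^+ 2) * (y ^+ 2 * (quad w x * quad w y)).
    by rewrite (mulrA x) (mulrA x) xyyE -(mulrA _ (quad w x)) -(mulrA (iota _)).
  by rewrite iotaA -!exprD (exprD w 3 3) cube_root_cube mul1r rmorph1 mul1r.
by rewrite (tri_intertwine _ _ _ ABx) -/(quad w _) quad_sqr // mulrA.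
Qed.

End CubeRoot.

Lemma cube_root_sqr_root (w : K) : 1 + w + w ^+ 2 = 0 ->
  1 + w ^+ 2 + (w ^+ 2) ^+ 2 = 0.
Proof.
by move=> w_root; rewrite -exprM (exprSr w 3) cube_root_cube // mul1r addrAC.
Qed.

Lemma quad1_sqr x : x ^+ 3 = 1 -> quad 1 x * quad 1 x = iota 3 * quad 1 x.
Proof. by move=> x3; rewrite triM // tri_scale; congr tri; ring. Qed.

(** The terms of [quad a y] in y and y^2 are annihilated by [quad_kill], for the roots w and w^2
    respectively. Only the constant term 1 survives, so the result does not depend on [a]. *)
Lemma quad_sandwich w a x y : 1 + w + w ^+ 2 = 0 -> x ^+ 3 = 1 ->
  x * y = iota w * (y * x) ->
  quad 1 x * quad a y * quad 1 x = iota 3 * quad 1 x.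
Proof.
move=> w_root x3 xy.
have xyy : x * y ^+ 2 = iota (w ^+ 2) * (y ^+ 2 * x).
  by rewrite !expr2 mulrA xy -2!mulrA xy iotaCA iotaA (mulrA y).
have k1 := quad_kill w_root x3 xy.
have k2 := quad_kill (cube_root_sqr_root w_root) x3 xyy.
have := quad1_sqr x3; move: (quad 1 x) k1 k2 => e k1 k2 ee.
rewrite /quad /tri rmorph1 !mulrDr !mulrDl mulr1 ee !iotaCA -!(mulrA (iota a)).
by rewrite k1 k2 !mulr0 !addr0.
Qed.

(** In a word over two neighbouring sites the outer letter pairs belong to one site and [c d] to the
    other. The regrouping leaves one word for each pair of letters that fail to commute;
    [word_splitC] serves the opposite order of the sites. *)
Lemma word_split (a b c d e f : B) : a * b = b * a -> a * c = c * a ->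
  a * f = f * a -> d * f = f * d -> e * f = f * e ->
  a * b * (c * d) * (e * f) = (b * c * f) * (a * d * e).
Proof.
move=> ab ac af df ef.
by rewrite ab -!mulrA ef (mulrA d) df (mulrA a c) ac -!mulrA (mulrA a f) af
  -!mulrA.
Qed.

Lemma word_splitC (a b c d e f : B) : b * d = d * b -> b * e = e * b ->
  c * d = d * c -> c * e = e * c ->
  a * b * (c * d) * (e * f) = (a * d * e) * (b * c * f).
Proof.
move=> bd be cd ce.
by rewrite cd -!mulrA (mulrA c e) ce (mulrA b) bd -!mulrA (mulrA b e) be
  -!mulrA.
Qed.

Section BMWElements.
Variables (w j : K).
Hypotheses (w_root : 1 + w + w ^+ 2 = 0) (j2 : j ^+ 2 = - 1) (K3 : 3 != 0 :> K).

(** The elements G, G^-1 and E of one site. The square root [j] of -1 will also serve as the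
    parameter r and as q - q^-1. *)
Definition hg u p : B := iota (j / 3) * (quad w p * quad w u).
Definition hgV u p : B := iota (- j / 3) * (quad (w ^+ 2) p * quad (w ^+ 2) u).
Definition he u p : B := iota (3^-1) * (quad 1 p * quad 1 u).

Section OneSite.
Variables (u p : B).
Hypotheses (u3 : u ^+ 3 = 1) (p3 : p ^+ 3 = 1) (up : u * p = p * u).

Lemma quad_commute a b x y : x * y = y * x ->
  quad a x * quad b y = quad b y * quad a x.
Proof. by move=> xy; rewrite tri_comm // tri_comm. Qed.

Lemma pair_mul a b c d : (quad a p * quad b u) * (quad c p * quad d u) =
  (quad a p * quad c p) * (quad b u * quad d u).
Proof. by rewrite -!mulrA (mulrA (quad b u)) (quad_commute b c up) !mulrA. Qed.

Lemma triC a x : tri a 0 0 x = iota a.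
Proof. by rewrite /tri rmorph0 !mul0r !addr0. Qed.

(** The constant coefficient of the product is 1 + 2 w^3 = 3 and the other two are 1 + w + w^2 =
    0. *)
Lemma quad_inv x : x ^+ 3 = 1 -> quad w x * quad (w ^+ 2) x = iota 3.
Proof.
have w2 := cube_root_sqr w_root.
by move=> x3; rewrite triM // -(triC 3 x); congr tri; ring: w2.
Qed.

Lemma quad_invC x : x ^+ 3 = 1 -> quad (w ^+ 2) x * quad w x = iota 3.
Proof. by move=> x3; rewrite quad_commute // quad_inv. Qed.

Lemma hgK : hg u p * hgV u p = 1.
Proof.
rewrite /hg /hgV iotaM pair_mul !quad_inv // -rmorphM -rmorphM -(rmorph1 iota).
by congr (iota _); field: j2.
Qed.

Lemma hgVK : hgV u p * hg u p = 1.
Proof.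
rewrite /hg /hgV iotaM pair_mul !quad_invC // -rmorphM -rmorphM -(rmorph1 iota).
by congr (iota _); field: j2.
Qed.

Lemma h_skein : hg u p - hgV u p = iota j * (1 - he u p).
Proof.
have qE a x : quad a x = 1 + iota a * (x + x ^+ 2) by rewrite /quad /tri
  rmorph1 mulrDr addrA.
(* Everything is now affine in y = p + p^2 and in z = u + u^2, so it is enough to compare the
   coefficients of 1, y, z and y z. *)
rewrite /hg /hgV /he !qE; move: (p + _) (u + _) => y z.
have bilin k a b : iota k * ((1 + iota a * y) * (1 + iota b * z)) =
    iota k + iota (k * a) * y + iota (k * b) * z + iota (k * a * b) * (y * z).
  rewrite mulrDl mul1r !mulrDr !mulr1 iotaM !iotaA (mulrA k a).
  by rewrite [LHS](AC (2*2) (1*3*2*4)).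
have w2 := cube_root_sqr w_root;
  rewrite mulrBr mulr1 iotaA !bilin !opprD -!mulNr -!rmorphN.
rewrite [LHS](AC (4*4) ((1*5)*(2*6)*(3*7)*(4*8))) /= -!mulrDl -!rmorphD.
rewrite [in RHS]addrA [in RHS]addrA [in RHS]addrA -rmorphD.
by congr (iota _ + iota _ * _ + iota _ * _ + iota _ * _); field: w2 j2.
Qed.

(** Multiplying [quad 1 x] by [quad w x] scales it by the coefficient sum 1 + 2 w. Since (1 + 2 w)^2
    = -3, the total factor is (j/3)(-3) = -j = j^-1. *)
Lemma h_twist : he u p * hg u p = iota j^-1 * he u p.
Proof.
rewrite /hg /he iotaM pair_mul iotaA.
have qq x : x ^+ 3 = 1 -> quad 1 x * quad w x = iota (1 + 2 * w) * quad 1 x.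
  by move=> x3; rewrite triM // tri_scale; congr tri; ring.
rewrite !qq // iotaM iotaA; congr (iota _ * _).
have j0 : j != 0 by apply: contra_eq_neq j2 => ->;
  rewrite expr0n eq_sym oppr_eq0 oner_eq0.
have w2 := cube_root_sqr w_root.
by field: w2 j2; rewrite K3.
Qed.

End OneSite.

Section TwoSites.
Variables (u1 p1 u2 p2 : B).
Hypotheses (u13 : u1 ^+ 3 = 1) (p13 : p1 ^+ 3 = 1).
Hypotheses (u23 : u2 ^+ 3 = 1) (p23 : p2 ^+ 3 = 1).
Hypotheses (u1p1 : u1 * p1 = p1 * u1) (u2p2 : u2 * p2 = p2 * u2).
Hypotheses (u1u2 : u1 * u2 = u2 * u1) (p1p2 : p1 * p2 = p2 * p1).

Lemma hg_far : u1 * p2 = p2 * u1 -> p1 * u2 = u2 * p1 ->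
  hg u1 p1 * hg u2 p2 = hg u2 p2 * hg u1 p1.
Proof.
move=> u1p2 p1u2; rewrite /hg !iotaM; congr (_ * _).
rewrite -!mulrA (mulrA (quad w u1)) (quad_commute w w u1p2).
rewrite -(mulrA (quad w p2)) (quad_commute w w u1u2) (mulrA (quad w p1)).
rewrite (quad_commute w w p1p2) -!mulrA; congr (_ * _).
by rewrite !mulrA (quad_commute w w p1u2).
Qed.

Hypotheses (u1p2 : u1 * p2 = iota w * (p2 * u1)).
Hypotheses (p1u2 : p1 * u2 = iota w * (u2 * p1)).

Lemma iotaM3 k l m x y z : iota k * x * (iota l * y) * (iota m * z) =
  iota (k * l * m) * (x * y * z).
Proof. by rewrite !iotaM. Qed.

Lemma hg_braid :
  hg u1 p1 * hg u2 p2 * hg u1 p1 = hg u2 p2 * hg u1 p1 * hg u2 p2.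
Proof.
have cc a b x y (xy : x * y = y * x) := quad_commute a b xy.
rewrite /hg !iotaM3; congr (_ * _).
rewrite word_split ?[RHS]word_splitC; do ?exact: cc.
  by rewrite (quad_braid w_root u13 p23) // (quad_braid w_root p13 u23).
Qed.

End TwoSites.

(** The middle factor is general enough to cover both g and g^-1, and the two roots [v], [v'] allow
    either order of the neighbouring sites. After [word_split] each pair is a case of
    [quad_sandwich]. *)
Lemma hege (u1 p1 u2 p2 : B) v v' a b k : u1 ^+ 3 = 1 -> p1 ^+ 3 = 1 ->
  1 + v + v ^+ 2 = 0 -> 1 + v' + v' ^+ 2 = 0 ->
  u1 * p1 = p1 * u1 -> u1 * u2 = u2 * u1 -> p1 * p2 = p2 * p1 ->
  u1 * p2 = iota v * (p2 * u1) -> p1 * u2 = iota v' * (u2 * p1) ->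
  he u1 p1 * (iota k * (quad a p2 * quad b u2)) * he u1 p1 =
  iota (3 * k) * he u1 p1.
Proof.
move=> u13 p13 vr vr' up uu pp u1p2 p1u2.
have cc c d x y (xy : x * y = y * x) := quad_commute c d xy.
rewrite /he iotaM3 word_split; do ?exact: cc.
rewrite (quad_sandwich b vr') // (quad_sandwich a vr) // iotaM.
rewrite (cc _ _ _ _ up) !iotaA; congr (iota _ * _); by field.
Qed.

End BMWElements.
End Quad.

(** * The BMW relations for a chain of Heisenberg pairs *)

Section HeisenbergRepresentation.
Variables (K : fieldType) (B : pzRingType) (iota : {rmorphism K -> B}).
Hypothesis iotaC : forall a b, iota a * b = b * iota a.
Variables (w q j : K).
Hypotheses (w_root : 1 + w + w ^+ 2 = 0) (j2 : j ^+ 2 = - 1) (K3 : 3 != 0 :> K).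
Hypothesis q_diff : q - q^-1 = j.

Variables (n : nat) (U P : 'I_n.-1 -> B).
Hypotheses (U3 : forall i, U i ^+ 3 = 1) (P3 : forall i, P i ^+ 3 = 1).
Hypotheses (UU : forall i k, U i * U k = U k * U i).
Hypotheses (PP : forall i k, P i * P k = P k * P i).
Hypothesis UP_far : forall i k, ~~ adjacent i k -> U i * P k = P k * U i.
Hypothesis UP_next : forall i k : 'I_n.-1, i.+1 = k :> nat ->
  U i * P k = iota w * (P k * U i).
Hypothesis PU_next : forall i k : 'I_n.-1, i.+1 = k :> nat ->
  P i * U k = iota w * (U k * P i).

Definition heis_gen (x : bmw_gen n) : B :=
  match x with
  | BG i => hg iota w j (U i) (P i)
  | BGinv i => hgV iota w j (U i) (P i)
  | BE i => he iota (U i) (P i)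
  end.

Lemma not_adjacentxx m (i : 'I_m) : ~~ adjacent i i.
Proof. by rewrite /adjacent -[X in _ == X]addn0 -addn1 eqn_add2l. Qed.

Lemma adjacentC m (i k : 'I_m) : adjacent i k = adjacent k i.
Proof. exact: orbC. Qed.

Let UP i : U i * P i = P i * U i.
Proof. exact/UP_far/not_adjacentxx. Qed.

Let flip x y : x * y = iota w * (y * x) -> y * x = iota (w ^+ 2) * (x * y).
Proof. by move=> ->; rewrite iotaA -exprSr (cube_root_cube w_root) rmorph1
  mul1r. Qed.

Let he_sandwich i k a b c : adjacent i k ->
  he iota (U i) (P i) * (iota c * (quad iota a (P k) * quad iota b (U k))) *
  he iota (U i) (P i) = iota (3 * c) * he iota (U i) (P i).
Proof.
case/orP=> /eqP ik.
  by apply: (hege _ _ _ (v := w) (v' := w)) => //;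
    [exact: UP_next | exact: PU_next].
(* With the sites in the opposite order the commutation factor is inverted to w^2, again a root of 1
   + X + X^2. *)
by apply: (hege _ _ _ (v := w ^+ 2) (v' := w ^+ 2)) => //;
  rewrite ?(cube_root_sqr_root w_root) //; apply: flip;
    [exact: PU_next | exact: UP_next].
Qed.

(** The parameter r is [j]: the twist factor is j^-1, and the two sandwich relations have the
    factors 3 (j/3) = j and 3 (-j/3) = j^-1. *)
Lemma heis_rel s t : bmw_rel j q s t ->
  alg_eval iota heis_gen s = alg_eval iota heis_gen t.
Proof.
case=> {s t} /= [i|i|i k _ ik|i k|i|i|i k ik|i k ik].
- by rewrite rmorph1 hgK.
- by rewrite rmorph1 hgVK.
- have ki : ~~ adjacent k i by rewrite adjacentC.
  by apply: hg_far => //; [exact: UP_far | rewrite UP_far].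
- case/orP=> /eqP ik; first by apply: (hg_braid iotaC j w_root) => //;
    [exact: UP_next | exact: PU_next].
  by apply/esym/(hg_braid iotaC j w_root) => //;
    [exact: UP_next | exact: PU_next].
- by rewrite !rmorphN !rmorph1 !mulN1r h_skein // q_diff.
- exact: h_twist.
- by rewrite he_sandwich //; congr (iota _ * _); field.
- have jV : j^-1 = - j.
    have j0 : j != 0 by apply: contra_eq_neq j2 => ->;
      rewrite expr0n eq_sym oppr_eq0 oner_eq0.
    by field: j2.
  by rewrite he_sandwich // jV; congr (iota _ * _); field.
Qed.

End HeisenbergRepresentation.

(** * Spanning the BMW algebra *)

Section PresentedAlgebraTheory.
Variables (K : fieldType) (X : Type).
Variable rel : alg_term K X -> alg_term K X -> Prop.

Lemma alg_eval_pclass t : alg_eval (pcst rel) (pgen rel) t = pclass rel t.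
Proof.
elim: t => //= s -> t ->; first exact: pclassD.
exact: pclassM.
Qed.

(** Evaluation in the algebra itself turns a formal relation into an equation between products, from
    which the BMW relations are read off. *)
Lemma presented_rel s t : rel s t ->
  alg_eval (pcst rel) (pgen rel) s = alg_eval (pcst rel) (pgen rel) t.
Proof. by move=> st; rewrite !alg_eval_pclass; apply/pclassP/cong_rel. Qed.

Lemma presented_ind (Q : presented_alg rel -> Prop) :
  (forall x, Q (pgen rel x)) -> (forall c, Q (pcst rel c)) ->
  (forall x y, Q x -> Q y -> Q (x + y)) ->
  (forall x y, Q x -> Q y -> Q (x * y)) -> forall x, Q x.
Proof.
move=> Qg Qc QD QM; apply: pclass_ind => t; rewrite -alg_eval_pclass.
by elim: t => //= s Qs t Qt; [exact: QD | exact: QM].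
Qed.

End PresentedAlgebraTheory.

Section BMWTheory.
Variables (K : fieldType) (r q : K).
Hypotheses (r0 : r != 0) (qq0 : q - q^-1 != 0).

Section Relations.
Variable n : nat.
Local Notation g := (@bmw_g K r q n).
Local Notation gV := (@bmw_gV K r q n).
Local Notation e := (@bmw_e K r q n).
Local Notation c := (q - q^-1).
Implicit Types i k : 'I_n.-1.

Lemma bmw_ind (Q : bmw r q n -> Prop) :
  (forall i, Q (g i)) -> (forall i, Q (gV i)) -> (forall i, Q (e i)) ->
  (forall a, Q a%:A) -> (forall x y, Q x -> Q y -> Q (x + y)) ->
  (forall x y, Q x -> Q y -> Q (x * y)) -> forall x, Q x.
Proof.
move=> Qg QgV Qe Qc QD QM; apply: presented_ind => //; first by case.
by move=> a; have := Qc a; rewrite /GRing.scale /= /pscale mulr1.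
Qed.

Lemma bmw_gK i : g i * gV i = 1.
Proof. exact: (presented_rel (bmwr_gV r q i)). Qed.

Lemma bmw_gVK i : gV i * g i = 1.
Proof. exact: (presented_rel (bmwr_Vg r q i)). Qed.

Lemma bmw_far i k : i != k -> ~~ adjacent i k -> g i * g k = g k * g i.
Proof. by move=> ik nik; exact: (presented_rel (bmwr_far r q ik nik)). Qed.

Lemma bmw_braid i k : adjacent i k -> g i * g k * g i = g k * g i * g k.
Proof. by move=> ik; exact: (presented_rel (bmwr_braid r q ik)). Qed.

Lemma bmw_twist i : e i * g i = r^-1 *: e i.
Proof. exact: (presented_rel (bmwr_twist r q i)). Qed.

Lemma bmw_ege i k : adjacent i k -> e i * g k * e i = r *: e i.
Proof. by move=> ik; exact: (presented_rel (bmwr_ege r q ik)). Qed.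

Lemma bmw_egVe i k : adjacent i k -> e i * gV k * e i = r^-1 *: e i.
Proof. by move=> ik; exact: (presented_rel (bmwr_egVe r q ik)). Qed.

Lemma bmw_skein i : g i - gV i = c *: (1 - e i).
Proof.
have := presented_rel (bmwr_skein r q i).
by rewrite /= !rmorphN !rmorph1 !mulN1r.
Qed.

Lemma bmw_eE i : e i = 1 - c^-1 *: (g i - gV i).
Proof. by rewrite bmw_skein scalerA mulVf // scale1r opprB addrC subrK. Qed.

Lemma bmw_gE i : g i = gV i + c *: (1 - e i).
Proof. by rewrite -bmw_skein addrC subrK. Qed.

Lemma bmw_comm_gV i (x : bmw r q n) : x * g i = g i * x -> x * gV i = gV i * x.
Proof.
move=> xg; rewrite -[LHS]mul1r -(bmw_gVK i) -mulrA (mulrA (g i)) -xg.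
by rewrite -mulrA bmw_gK mulr1.
Qed.

Lemma bmw_comm_e i (x : bmw r q n) : x * g i = g i * x -> x * e i = e i * x.
Proof.
move=> xg; have xgV := bmw_comm_gV xg.
by rewrite bmw_eE mulrBr mulrBl mulr1 mul1r -scalerAr -scalerAl mulrBr mulrBl
  xg xgV.
Qed.

Lemma bmw_eg_comm i : g i * e i = e i * g i.
Proof. exact: bmw_comm_e. Qed.

Lemma bmw_egV i : e i * gV i = r *: e i.
Proof.
have eE : e i = r *: (e i * g i) by rewrite bmw_twist scalerA divff // scale1r.
by rewrite {1}eE -scalerAl -mulrA bmw_gK mulr1.
Qed.

Lemma bmw_e_sqr i : e i * e i = (1 - c^-1 * (r^-1 - r)) *: e i.
Proof.
rewrite {2}bmw_eE mulrBr mulr1 -scalerAr mulrBr bmw_twist bmw_egV.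
by rewrite -scalerBl scalerA scalerBl scale1r.
Qed.

(** By the skein relation e is a combination of 1, g and g^-1, so conjugation by g_i g_k need only
    be checked on those; both nontrivial cases come from the braid relation. *)
Lemma bmw_gge i k : adjacent i k -> g i * g k * e i = e k * g i * g k.
Proof.
move=> ik; rewrite !bmw_eE mulrBr !mulrBl mulr1 mul1r; congr (_ - _).
rewrite -scalerAr -!scalerAl; congr (_ *: _).
rewrite mulrBr !mulrBl bmw_braid //; congr (_ - _).
rewrite -[LHS]mul1r -(bmw_gVK k) -!mulrA; congr (_ * _).
rewrite !mulrA -(bmw_braid ik) -!mulrA bmw_gK mulr1 //.
Qed.

Lemma bmw_gVeg i k : adjacent i k -> gV i * e k * g i = g k * e i * gV k.
Proof.
move=> ik; rewrite -[RHS]mul1r -(bmw_gVK i) -!mulrA; congr (_ * _).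
by rewrite !mulrA bmw_gge // -!mulrA bmw_gK mulr1.
Qed.

(** Insert g_k g_k^-1 before e_i. The twist absorbs g_k into e_k, [bmw_gVeg] turns the rest into g_i
    e_k g_i^-1, and e_k g_i e_k = r e_k. *)
Lemma bmw_eeg i k : adjacent i k -> e k * e i * g k = e k * gV i.
Proof.
move=> ik; have eE : e k = r *: (e k * g k).
  by rewrite bmw_twist scalerA divff // scale1r.
have ki : adjacent k i by rewrite /adjacent orbC.
rewrite -[e i]mul1r -(bmw_gK k) -!mulrA (mulrA (gV k)) bmw_gVeg // !mulrA.
by rewrite bmw_twist -!scalerAl bmw_ege // -scalerAl scalerA mulVf // scale1r.
Qed.

Lemma bmw_gee i k : adjacent i k -> g k * e i * e k = gV i * e k.
Proof.
move=> ik; rewrite -[e i]mulr1 -(bmw_gVK k) !mulrA -bmw_gVeg // -!mulrA.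
have ki : adjacent k i by rewrite /adjacent orbC.
rewrite bmw_eg_comm bmw_twist -!scalerAr (mulrA (e k)) bmw_ege //.
by rewrite -scalerAr scalerA mulVf // scale1r.
Qed.

Lemma bmw_eee i k : adjacent i k -> exists a, e k * e i * e k = a *: e k.
Proof.
move=> ik; have ki : adjacent k i by rewrite /adjacent orbC.
(* This comes from expanding e_i by the skein relation; the two correction terms cancel, so the
   scalar is 1. *)
exists (1 - c^-1 * (r^-1 - r) - c^-1 * (r - r^-1)).
rewrite [e i]bmw_eE mulrBr mulr1 -scalerAr mulrBl mulrBr -scalerAl mulrBl.
by rewrite bmw_ege // bmw_egVe // bmw_e_sqr -scalerBl scalerA -scalerBl.
Qed.

End Relations.

Section Spanning.
Variable n : nat.
Local Notation incl := (@bmw_incl K r q n.+1).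
Local Notation g := (@bmw_g K r q n.+2 ord_max).
Local Notation e := (@bmw_e K r q n.+2 ord_max).

(** The subspace C + C g C + C e C, with C the image of the algebra on one strand fewer. Scalars are
    absorbed into C, and g^-1 is reached through the skein relation. *)
Inductive bmw_spanned : bmw r q n.+2 -> Prop :=
| spanned_1 a : bmw_spanned (incl a)
| spanned_g a b : bmw_spanned (incl a * g * incl b)
| spanned_e a b : bmw_spanned (incl a * e * incl b)
| spanned_D x y : bmw_spanned x -> bmw_spanned y -> bmw_spanned (x + y).

Lemma spanned_bimod a b x : bmw_spanned x -> bmw_spanned (incl a * x * incl b).
Proof.
elim=> {x} [c|c d|c d|x y _ sx _ sy].
- by rewrite -!rmorphM; exact: spanned_1.
- by rewrite !mulrA -mulrA -!rmorphM; exact: spanned_g.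
- by rewrite !mulrA -mulrA -!rmorphM; exact: spanned_e.
- by rewrite mulrDr mulrDl; exact: spanned_D.
Qed.

Lemma spanned_scale c x : bmw_spanned x -> bmw_spanned (c *: x).
Proof.
by move/(spanned_bimod c%:A 1);
  rewrite linearZ /= !rmorph1 mulr1 -scalerAl mul1r.
Qed.

Lemma spanned_B x y : bmw_spanned x -> bmw_spanned y -> bmw_spanned (x - y).
Proof. by move=> sx sy; rewrite -scaleN1r; apply/spanned_D/spanned_scale. Qed.

Lemma spanned1 : bmw_spanned 1.
Proof. by rewrite -(rmorph1 incl); exact: spanned_1. Qed.

Lemma spannedg : bmw_spanned g.
Proof. by have := spanned_g 1 1; rewrite rmorph1 mulr1 mul1r. Qed.

Lemma spannede : bmw_spanned e.
Proof. by have := spanned_e 1 1; rewrite rmorph1 mulr1 mul1r. Qed.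

End Spanning.

Lemma bmw_incl_g n i : bmw_incl (bmw_g r q i) =
  bmw_g r q (n := n.+1) (widen_ord (leq_pred n) i).
Proof. exact: (presented_lift_gen (@pcstC _ _ _) (@bmw_widen_rel K r q n)). Qed.

Lemma bmw_incl_gV n i : bmw_incl (bmw_gV r q i) =
  bmw_gV r q (n := n.+1) (widen_ord (leq_pred n) i).
Proof. exact: (presented_lift_gen (@pcstC _ _ _) (@bmw_widen_rel K r q n)). Qed.

Lemma bmw_incl_e n i : bmw_incl (bmw_e r q i) =
  bmw_e r q (n := n.+1) (widen_ord (leq_pred n) i).
Proof. exact: (presented_lift_gen (@pcstC _ _ _) (@bmw_widen_rel K r q n)). Qed.

Lemma bmw_small (n : nat) (x : bmw r q n) : (n <= 1)%N -> exists a, x = a%:A.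
Proof.
move=> n1; have n0 : n.-1 = 0%N by case: n n1 {x} => [|[|]].
have no (i : 'I_n.-1) : False by case: i => m; rewrite n0.
elim/bmw_ind: x => [i|i|i|a|x y [a ->] [b ->]|x y [a ->] [b ->]];
  try by case: (no i).
- by exists a.
- by exists (a + b); rewrite scalerDl.
- by exists (a * b); rewrite -scalerAl mul1r scalerA.
Qed.

Section LastLetters.
Variable n : nat.
Local Notation incl := (@bmw_incl K r q n.+1).
Local Notation g := (@bmw_g K r q n.+2 ord_max).
Local Notation gV := (@bmw_gV K r q n.+2 ord_max).
Local Notation e := (@bmw_e K r q n.+2 ord_max).

Lemma spanned_gg : bmw_spanned (g * g).
Proof.
rewrite {2}bmw_gE mulrDr bmw_gK -scalerAr mulrBr mulr1 bmw_eg_comm bmw_twist.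
apply: spanned_D; first exact: spanned1.
by apply/spanned_scale/spanned_B;
  [exact: spannedg | apply/spanned_scale/spannede].
Qed.

Lemma spanned_eg : bmw_spanned (e * g).
Proof. by rewrite bmw_twist; apply/spanned_scale/spannede. Qed.

Lemma spanned_ge : bmw_spanned (g * e).
Proof. by rewrite bmw_eg_comm; exact: spanned_eg. Qed.

Lemma spanned_ee : bmw_spanned (e * e).
Proof. by rewrite bmw_e_sqr; apply/spanned_scale/spannede. Qed.

End LastLetters.

Section Step.
Variable n : nat.
Local Notation incl := (@bmw_incl K r q n.+2).
Local Notation i := (widen_ord (leq_pred n.+2) ord_max : 'I_n.+3.-1).
Local Notation k := (ord_max : 'I_n.+3.-1).
Local Notation gi := (bmw_g r q (n := n.+3) i).
Local Notation gVi := (bmw_gV r q (n := n.+3) i).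
Local Notation ei := (bmw_e r q (n := n.+3) i).
Local Notation g := (@bmw_g K r q n.+3 ord_max).
Local Notation e := (@bmw_e K r q n.+3 ord_max).

Let adj : adjacent i k.
Proof. by rewrite /adjacent /= eqxx. Qed.

Let adj' : adjacent k i.
Proof. by rewrite /adjacent /= eqxx orbT. Qed.

Let sg a b : bmw_spanned (incl a * g * incl b).
Proof. exact: spanned_g. Qed.

Let se a b : bmw_spanned (incl a * e * incl b).
Proof. exact: spanned_e. Qed.

Lemma spanned_gig : bmw_spanned (g * gi * g).
Proof. by rewrite bmw_braid // -!bmw_incl_g; exact: sg. Qed.

Lemma spanned_gie : bmw_spanned (g * gi * e).
Proof. by rewrite bmw_gge // -bmw_incl_g -bmw_incl_e; exact: sg. Qed.

Lemma spanned_eig : bmw_spanned (e * gi * g).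
Proof. by rewrite -bmw_gge // -bmw_incl_g -bmw_incl_e; exact: sg. Qed.

Lemma spanned_eie : bmw_spanned (e * gi * e).
Proof. by rewrite bmw_ege //; apply/spanned_scale/spannede. Qed.

Lemma spanned_gee : bmw_spanned (g * ei * e).
Proof. by rewrite bmw_gee // -bmw_incl_gV -[_ * e]mulr1 -(rmorph1 incl);
  exact: se. Qed.

Lemma spanned_eeg : bmw_spanned (e * ei * g).
Proof. by rewrite bmw_eeg // -bmw_incl_gV -[e]mul1r -(rmorph1 incl);
  exact: se. Qed.

Lemma spanned_eee : bmw_spanned (e * ei * e).
Proof. by have [a ->] := bmw_eee adj; apply/spanned_scale/spannede. Qed.

(** Replacing the last g by g^-1 + c (1 - e), with c = q - q^-1, gives the leading term g e_i g^-1 =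
    g_i^-1 e g_i, which has a single last letter. The remaining terms are g e_i and g e_i e. *)
Lemma spanned_geg : bmw_spanned (g * ei * g).
Proof.
rewrite {2}bmw_gE mulrDr -bmw_gVeg // -scalerAr mulrBr mulr1.
apply: spanned_D; first by rewrite -bmw_incl_gV -bmw_incl_g; exact: se.
apply/spanned_scale/spanned_B; last exact: spanned_gee.
by rewrite -bmw_incl_e -[g]mul1r -(rmorph1 incl); exact: sg.
Qed.

(** The last generator touches only the last two strands, while the twice included element lives on
    the strands before them. *)
Lemma bmw_far_commute (a : bmw r q n.+1) :
  GRing.comm g (incl (bmw_incl a)) /\ GRing.comm e (incl (bmw_incl a)).
Proof.
have far_g (i : 'I_n.+1.-1) : GRing.comm g (incl (bmw_incl (bmw_g r q i))).
  rewrite !bmw_incl_g; apply: bmw_far; case: i => i /= ni.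
    by apply/eqP => /(congr1 val) /= E; move: ni; rewrite -E ltnNge leqnSn.
  by rewrite /adjacent /= eqSS (ltn_eqF ni) orbF gtn_eqF // !ltnS (leq_trans
    (ltnW ni)).
have comm_e x : GRing.comm g x -> GRing.comm e x by move=> gx;
  apply/esym/bmw_comm_e.
suff gc : GRing.comm g (incl (bmw_incl a)) by split; [|exact: comm_e].
elim/bmw_ind: a => [i|i|i|a|x y gx gy|x y gx gy].
- exact: far_g.
- have := far_g i; rewrite !bmw_incl_g !bmw_incl_gV; exact: bmw_comm_gV.
- have := far_g i; rewrite !bmw_incl_g !bmw_incl_e; exact: bmw_comm_e.
- by rewrite !(linearZ, rmorph1) /=;
    rewrite /GRing.comm -scalerAr -scalerAl mulr1 mul1r.
- by rewrite !rmorphD; exact: commrD.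
- by rewrite !rmorphM; exact: commrM.
Qed.

End Step.

Lemma bmw_last_split n (i : 'I_n.+2.-1) :
  i = ord_max \/ exists i' : 'I_n.+1.-1, i = widen_ord (leq_pred n.+1) i'.
Proof.
have [im|im] := eqVneq i ord_max; [by left | right].
have lt_in : (i < n)%N by rewrite ltn_neqAle -ltnS ltn_ord andbT.
by exists (Ordinal lt_in); apply: val_inj.
Qed.

Section Letters.
Variable n : nat.
Local Notation g := (@bmw_g K r q n.+2 ord_max).
Local Notation e := (@bmw_e K r q n.+2 ord_max).

Definition last_letter (x : bmw r q n.+2) : Prop := x = g \/ x = e.

Lemma spanned_letters2 x y : last_letter x -> last_letter y ->
  bmw_spanned (x * y).
Proof.
case=> -> [] ->; [exact: spanned_gg | exact: spanned_ge |
                  exact: spanned_eg | exact: spanned_ee].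
Qed.

Lemma spanned_letter x : last_letter x -> bmw_spanned x.
Proof. by case=> ->; [exact: spannedg | exact: spannede]. Qed.

(** A subspace that contains 1 and is stable under left multiplication by the generators is
    everything. Stability under the included generators is built into [bmw_spanned], so only words
    starting with a last letter remain. *)
Lemma spanned_closed :
  (forall x a y, last_letter x -> last_letter y ->
     bmw_spanned (x * bmw_incl a) /\ bmw_spanned (x * bmw_incl a * y)) ->
  forall x : bmw r q n.+2, bmw_spanned x.
Proof.
move=> spl x; suff: forall z, bmw_spanned z -> bmw_spanned (x * z).
  by move=> /(_ 1); rewrite mulr1; apply; exact: spanned1.
have lg : last_letter g by left.
have le : last_letter e by right.
have letterP L : last_letter L -> forall z, bmw_spanned z ->
  bmw_spanned (L * z).
  move=> lL z; elim=> {z} [a|a b|a b|y z _ sy _ sz].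
  - by have [] := spl L a g lL lg.
  - have -> : L * (bmw_incl a * g * bmw_incl b) =
        bmw_incl 1 * (L * bmw_incl a * g) * bmw_incl b.
      by rewrite rmorph1 mul1r !mulrA.
    by apply: spanned_bimod; have [] := spl L a g lL lg.
  - have -> : L * (bmw_incl a * e * bmw_incl b) =
        bmw_incl 1 * (L * bmw_incl a * e) * bmw_incl b.
      by rewrite rmorph1 mul1r !mulrA.
    by apply: spanned_bimod; have [] := spl L a e lL le.
  - by rewrite mulrDr; exact: spanned_D.
have inclP a z : bmw_spanned z -> bmw_spanned (bmw_incl a * z).
  by move/(spanned_bimod a 1); rewrite rmorph1 mulr1.
elim/bmw_ind: x => [i|i|i|a|x y sx sy|x y sx sy] z sz.
- by have [->|[i' ->]] := bmw_last_split i;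
    [exact: letterP | rewrite -bmw_incl_g; exact: inclP].
- have [->|[i' ->]] := bmw_last_split i; last by rewrite -bmw_incl_gV;
    exact: inclP.
  (* The inverse of the last generator is rewritten as g - c (1 - e), with c = q - q^-1. *)
  rewrite -[bmw_gV _ _ _](subKr (bmw_g r q (n := n.+2) ord_max)) bmw_skein
    mulrBl -scalerAl mulrBl mul1r.
  by apply: spanned_B; [exact: letterP | apply/spanned_scale/spanned_B => //;
    exact: letterP].
- by have [->|[i' ->]] := bmw_last_split i;
    [exact: letterP | rewrite -bmw_incl_e; exact: inclP].
- by rewrite -scalerAl mul1r; exact: spanned_scale.
- by rewrite mulrDl; apply: spanned_D; [exact: sx | exact: sy].
- by rewrite -mulrA; apply/sx/sy.
Qed.

End Letters.

Lemma spanned_letter_incl n (x : bmw r q n.+2) a : last_letter x ->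
  bmw_spanned (x * bmw_incl a).
Proof.
by case=> ->; [have := spanned_g 1 a | have := spanned_e 1 a];
  rewrite rmorph1 mul1r.
Qed.

Lemma spanned_letters3 n (x y : bmw r q n.+3) m :
  last_letter x -> last_letter m -> last_letter y ->
    bmw_spanned (x * bmw_incl m * y).
Proof.
case=> -> [] -> [] ->; rewrite ?bmw_incl_g ?bmw_incl_e.
- exact: spanned_gig.
- exact: spanned_gie.
- exact: spanned_geg.
- exact: spanned_gee.
- exact: spanned_eig.
- exact: spanned_eie.
- exact: spanned_eeg.
- exact: spanned_eee.
Qed.

(** By induction the element between two last letters is a sum of terms b or b m d, with m a last
    letter of the smaller algebra and b, d two strands down. There b and d commute with the outer
    letters and can be pulled out, leaving words of at most three letters. *)
Lemma spanned_all n (x : bmw r q n.+2) : bmw_spanned x.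
Proof.
elim: n x => [|n IHn]; apply: spanned_closed => x a y lx ly.
  have [c ->] := bmw_small a isT.
  rewrite linearZ rmorph1 /= -scalerAr mulr1 -scalerAl.
  by split; apply: spanned_scale;
    [exact: spanned_letter | exact: spanned_letters2].
have far (b : bmw r q n.+1) L : last_letter L ->
  L * bmw_incl (bmw_incl b) = bmw_incl (bmw_incl b) * L.
  by have [gb eb] := bmw_far_commute b; case=> ->.
have bimod (z : bmw r q n.+3) (b d : bmw r q n.+1) : bmw_spanned z ->
    bmw_spanned (bmw_incl (bmw_incl b) * z * bmw_incl (bmw_incl d)).
  exact: spanned_bimod.
have one : bmw_incl (bmw_incl 1) = 1 :> bmw r q n.+3 by rewrite !rmorph1.
have mid (b d : bmw r q n.+1) m : last_letter m ->
    bmw_spanned (x * bmw_incl (bmw_incl b * m * bmw_incl d)) /\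
    bmw_spanned (x * bmw_incl (bmw_incl b * m * bmw_incl d) * y).
  move=> lm; rewrite !rmorphM.
  have -> : x * (bmw_incl (bmw_incl b) * bmw_incl m * bmw_incl (bmw_incl d)) =
      bmw_incl (bmw_incl b) * (x * bmw_incl m) * bmw_incl (bmw_incl d).
    by rewrite !mulrA (far b x).
  split; first by apply: bimod; exact: spanned_letter_incl.
  rewrite -mulrA -(far d y) // mulrA -(mulrA _ _ y).
  by apply: bimod; exact: spanned_letters3.
elim: {a}(IHn a) => [b|b d|b d|a b _ [sa say] _ [sb sby]].
- have E : x * bmw_incl (bmw_incl b) =
    bmw_incl (bmw_incl b) * x * bmw_incl (bmw_incl 1).
    by rewrite one mulr1 far.
  have E' : x * bmw_incl (bmw_incl b) * y =
      bmw_incl (bmw_incl b) * (x * y) * bmw_incl (bmw_incl 1).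
    by rewrite one mulr1 far // mulrA.
  by rewrite E' E; split; apply: bimod;
    [exact: spanned_letter | exact: spanned_letters2].
- by apply: mid; left.
- by apply: mid; right.
- by rewrite rmorphD mulrDr mulrDl; split; apply: spanned_D.
Qed.

End BMWTheory.

(** * Monomial operators on tensor powers *)

Section MonomialOperators.
Variable K : fieldType.

(* The operator e_x |-> c x *: e_(s x). *)
Definition mon (X Y : finType) (c : X -> K) (s : X -> Y) :
    'M[K]_(#|{: Y}|, #|{: X}|) :=
  \matrix_(a, b) (c (enum_val b) * (enum_val a == s (enum_val b))%:R).

Lemma eq_mon (X Y : finType) (c c' : X -> K) (s s' : X -> Y) :
  c =1 c' -> s =1 s' -> mon c s = mon c' s'.
Proof. by move=> cc ss; apply/matrixP=> a b; rewrite !mxE cc ss. Qed.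

Lemma mon_mul (X Y Z : finType) (c : Y -> K) (s : Y -> Z) (d : X -> K)
  (t : X -> Y) :
  mon c s *m mon d t = mon (fun x => d x * c (t x)) (s \o t).
Proof.
apply/matrixP=> a b; rewrite !mxE (bigD1 (enum_rank (t (enum_val b)))) //=.
rewrite !mxE enum_rankK eqxx mulr1 big1 => [|k kt]; last first.
  rewrite !mxE [_ == t _]negbTE ?mulr0 //.
  by apply: contra kt => /eqP <-; rewrite enum_valK.
by rewrite addr0 mulrC mulrA.
Qed.

Lemma mon_id (X : finType) : mon (fun=> 1) (@id X) = 1%:M.
Proof. by apply/matrixP=> a b; rewrite !mxE mul1r (inj_eq enum_val_inj). Qed.

Lemma monM (X : finType) (c : X -> K) (s : X -> X) d t :
  mon c s * mon d t = mon (fun x => d x * c (t x)) (s \o t).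
Proof. exact: mon_mul. Qed.

Lemma mon1 (X : finType) : mon (fun=> 1) (@id X) = 1.
Proof. exact: mon_id. Qed.

Lemma op_coef_mon (X : finType) (c : X -> K) (s : X -> X) x y :
  op_coef (mon c s) x y = c y * (x == s y)%:R.
Proof. by rewrite /op_coef mxE !enum_rankK. Qed.

(** Each summand is one row of [M]. This reduces identities that are linear in an operator to
    monomial operators. *)
Lemma op_mon_sum (X : finType) (M : endmx K X) :
  M = \sum_x mon (op_coef M x) (fun=> x).
Proof.
apply/matrixP=> a b; rewrite summxE (bigD1 (enum_val a)) //= !mxE eqxx.
rewrite /op_coef !enum_valK mulr1 big1 ?addr0 // => x xa.
by rewrite mxE eq_sym (negbTE xa) mulr0.
Qed.

(** * Local copies as algebra morphisms *)

Section LocalCopy.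
Variables (T : finType) (n : nat) (i : 'I_n.-1).
Local Notation i1 := (fst_factor i).
Local Notation i2 := (snd_factor i).

Lemma factors_neq : (i1 == i2) = false.
Proof. by apply/eqP=> /(congr1 val) /= /eqP;
  rewrite -[X in X == _]addn0 -addn1 eqn_add2l. Qed.

Definition on_pair (s : T * T -> T * T) (y : {ffun 'I_n -> T}) :
  {ffun 'I_n -> T} :=
  [ffun k => if k == i1 then (s (y i1, y i2)).1
             else if k == i2 then (s (y i1, y i2)).2 else y k].

Lemma on_pairE s y : (on_pair s y i1, on_pair s y i2) = s (y i1, y i2).
Proof. by rewrite !ffunE eqxx [i2 == i1]eq_sym factors_neq eqxx;
  case: (s _). Qed.

Lemma on_pair_comp s t y : on_pair (s \o t) y = on_pair s (on_pair t y).
Proof.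
apply/ffunP=> k; rewrite [LHS]ffunE [RHS]ffunE on_pairE /=.
by case: ifP => // k1; case: ifP => // k2; rewrite ffunE k1 k2.
Qed.

Lemma local_copy_mon (c : T * T -> K) s :
  local_copy (mon c s) i = mon (fun y : {ffun 'I_n -> T} =>
    c (y i1, y i2)) (on_pair s).
Proof.
apply/matrixP=> a b; rewrite !mxE op_coef_mon -mulrA; congr (_ * _).
move: (enum_val a) (enum_val b) => x y; rewrite -natrM mulnb; congr (_%:R);
  congr (nat_of_bool _).
apply/andP/eqP => [[/eqP sE /forallP xy]|->].
  apply/ffunP=> k; rewrite ffunE -sE /=; case: eqP => [->//|/eqP k1].
  by case: eqP => [->//|/eqP k2]; have := xy k; rewrite k1 k2 => /eqP.
split; first by rewrite !ffunE eqxx [i2 == i1]eq_sym factors_neq eqxx;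
  case: (s _).
by apply/forallP=> k; apply/implyP=> /andP[k1 k2];
  rewrite ffunE (negbTE k1) (negbTE k2).
Qed.

Definition local_op (M : endmx K (T * T)) := local_copy M i.

Fact local_op_is_linear : linear local_op.
Proof.
move=> a M N; apply/matrixP=> x y; rewrite !mxE /op_coef !mxE mulrDl.
by rewrite mulrA.
Qed.

HB.instance Definition _ := GRing.isLinear.Build K (endmx K (T * T))
  (endmx K {ffun 'I_n -> T}) *:%R local_op local_op_is_linear.

(** Both factors are expanded by [op_mon_sum]; for monomial operators multiplicativity is the
    composition law [on_pair_comp]. *)
Fact local_op_is_monoid_morphism : monoid_morphism local_op.
Proof.
split.
  rewrite -[1 in LHS]mon_id /local_op local_copy_mon -[RHS]mon_id;
    apply: eq_mon => // y.
  by apply/ffunP=> k; rewrite ffunE /=; case: eqP => [->//|_];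
    case: eqP => [->|].
move=> M N; rewrite (op_mon_sum M) (op_mon_sum N) mulr_suml !linear_sum
  mulr_suml.
apply: eq_bigr => p _; rewrite !mulr_sumr linear_sum; apply: eq_bigr => p' _ /=.
rewrite -![_ * _]/(_ *m _) mon_mul /local_op !local_copy_mon mon_mul.
apply: eq_mon => y; last exact: on_pair_comp.
by rewrite /= on_pairE.
Qed.

HB.instance Definition _ := GRing.isMonoidMorphism.Build (endmx K (T * T))
  (endmx K {ffun 'I_n -> T}) local_op local_op_is_monoid_morphism.

Lemma local_op_scalar a : local_op a%:M = a%:M.
Proof. by rewrite -[in LHS]scalemx1 -[in RHS]scalemx1 linearZ /= rmorph1. Qed.

Lemma local_op_tri a b c M :
  local_op (tri scalar_mx a b c M) = tri scalar_mx a b c (local_op M).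
Proof. by rewrite /tri !rmorphD 2!rmorphM rmorphXn /= !local_op_scalar. Qed.

Lemma local_op_pair a b c M N :
  local_op (c%:M * (quad scalar_mx a M * quad scalar_mx b N)) =
  c%:M * (quad scalar_mx a (local_op M) * quad scalar_mx b (local_op N)).
Proof.
have mul x y : local_op (x * y) = local_op x * local_op y by rewrite rmorphM.
by rewrite mul (local_op_scalar c) mul !local_op_tri.
Qed.

End LocalCopy.

(** * The operators U and P over the field with three elements *)

Section Cyclic.
Variable w : K.
Hypothesis w3 : w ^+ 3 = 1.

Definition chi (a : 'F_3) : K := w ^+ a.

Lemma chiD a b : chi (a + b) = chi a * chi b.
Proof. by rewrite /chi -exprD /= expr_mod. Qed.

Lemma chi0 : chi 0 = 1. Proof. by []. Qed.

Lemma chi1 : chi 1 = w. Proof. by []. Qed.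

Lemma chi_cube a : chi a ^+ 3 = 1.
Proof. by rewrite /chi -exprM mulnC exprM w3 expr1n. Qed.

Lemma chiN a : chi (- a) = chi a ^+ 2.
Proof.
have ca : chi a != 0 by apply: contra_eq_neq (chi_cube a) => ->;
  rewrite expr0n eq_sym oner_eq0.
apply: (mulIf ca); rewrite -exprSr chi_cube -chiD addNr //.
Qed.

Definition shift2 (p : 'F_3 * 'F_3) : 'F_3 * 'F_3 := (p.1 + 1, p.2 - 1).
Definition U2 : endmx K ('F_3 * 'F_3) := mon (fun=> w) shift2.
Definition P2 : endmx K ('F_3 * 'F_3) := mon (fun p => chi (1 + p.1 + p.2)) id.

Lemma F3_three : 1 + (1 + 1) = 0 :> 'F_3.
Proof. exact: val_inj. Qed.

Lemma U2_cube : U2 ^+ 3 = 1.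
Proof.
rewrite !exprS expr0 mulr1 !monM -mon1; apply: eq_mon => [|[x y]] /=.
  by rewrite -mulrA -!expr2 -exprS w3.
have E (a : 'F_3) : a + 1 + 1 + 1 = a by rewrite -!addrA F3_three addr0.
by congr (_, _); rewrite ?E // -!addrA -!opprD F3_three oppr0 addr0.
Qed.

Lemma P2_cube : P2 ^+ 3 = 1.
Proof.
rewrite !exprS expr0 mulr1 !monM -mon1; apply: eq_mon => [[x y]|//] /=.
by rewrite -mulrA -!expr2 -exprS chi_cube.
Qed.

Lemma U2P2 : U2 * P2 = P2 * U2.
Proof.
rewrite !monM; apply: eq_mon => [[x y]|//] /=; rewrite mulrC.
by congr (_ * chi _); rewrite -[RHS]addrA addrACA subrr addr0 addrA.
Qed.

Section Sites.
Variable n : nat.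
Local Notation X := {ffun 'I_n -> 'F_3}.
Implicit Types i k : 'I_n.-1.

Definition Uop i := local_op i U2.
Definition Pop i := local_op i P2.

(** A simple root of type A: U_i is w times the translation by it. *)
Definition root2 i : X := [ffun k =>
  (k == fst_factor i)%:R - (k == snd_factor i)%:R].
Definition pair_sum i (x : X) := x (fst_factor i) + x (snd_factor i).

Lemma UopE i : Uop i = mon (fun=> w) (fun x : X => x + root2 i).
Proof.
rewrite /Uop /local_op local_copy_mon; apply: eq_mon => // x.
apply/ffunP=> k; rewrite !ffunE /=; case: eqP => [->|_].
  by rewrite factors_neq subr0.
by case: eqP => [->|_] /=;
  rewrite ?sub0r ?subrr ?addr0 ?mulr0n ?sub0r ?subr0 ?addr0 /=.
Qed.

Lemma PopE i : Pop i = mon (fun x : X => chi (1 + pair_sum i x)) id.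
Proof.
rewrite /Pop /local_op local_copy_mon; apply: eq_mon => x /=;
  first by rewrite addrA.
by apply/ffunP=> k; rewrite ffunE /=; case: eqP => [->//|_]; case: eqP => [->|].
Qed.

Lemma Uop_cube i : Uop i ^+ 3 = 1.
Proof. by rewrite -rmorphXn U2_cube rmorph1. Qed.

Lemma Pop_cube i : Pop i ^+ 3 = 1.
Proof. by rewrite -rmorphXn P2_cube rmorph1. Qed.

Lemma UopC i k : Uop i * Uop k = Uop k * Uop i.
Proof. by rewrite !UopE !monM; apply: eq_mon => // x; rewrite /= addrAC. Qed.

Lemma PopC i k : Pop i * Pop k = Pop k * Pop i.
Proof. by rewrite !PopE !monM; apply: eq_mon => // x; rewrite /= mulrC. Qed.

Lemma pair_sumD i x y : pair_sum i (x + y) = pair_sum i x + pair_sum i y.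
Proof. by rewrite /pair_sum !ffunE addrACA. Qed.

Lemma mon_scale (Y Z : finType) a (c : Y -> K) (s : Y -> Z) :
  a *: mon c s = mon (fun x => a * c x) s.
Proof. by apply/matrixP=> x y; rewrite !mxE mulrA. Qed.

Lemma mulr_scalar_mx m a (A : 'M[K]_m) : a%:M * A = a *: A.
Proof. exact: mul_scalar_mx. Qed.

Lemma pair_sum_root2 i k :
  pair_sum k (root2 i) = (k.+1 == i :> nat)%:R - (k == i.+1 :> nat)%:R.
Proof.
rewrite /pair_sum !ffunE -!(inj_eq val_inj) /= eqSS.
by rewrite [LHS](AC (2*2) ((1*4)*(3*2))) /= subrr add0r.
Qed.

(** P_k is diagonal, given by a character of [pair_sum k], and U_i translates by [root2 i]; hence
    they commute up to the character value of the pairing of the two. *)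
Lemma Pop_Uop i k : Pop k * Uop i =
  (chi (pair_sum k (root2 i)))%:M * (Uop i * Pop k).
Proof.
rewrite UopE PopE !monM mulr_scalar_mx mon_scale; apply: eq_mon => // x /=.
by rewrite pair_sumD addrA chiD mulrA mulrC (mulrC w).
Qed.

Lemma Uop_Pop_far i k : ~~ adjacent i k -> Uop i * Pop k = Pop k * Uop i.
Proof.
rewrite /adjacent negb_or => /andP[ik ki]; rewrite Pop_Uop pair_sum_root2.
by rewrite (negbTE ki) [k == _ :> nat]eq_sym (negbTE ik) subr0 chi0
  mulr_scalar_mx scale1r.
Qed.

Lemma Pop_Uop_next i k : i.+1 = k :> nat ->
  Pop i * Uop k = w%:M * (Uop k * Pop i).
Proof.
move=> ik; rewrite Pop_Uop pair_sum_root2 ik eqxx -ik.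
by rewrite [_ == _.+2]ltn_eqF // subr0 chi1.
Qed.

Lemma Uop_Pop_next i k : i.+1 = k :> nat ->
  Uop i * Pop k = w%:M * (Pop k * Uop i).
Proof.
move=> ik; rewrite Pop_Uop pair_sum_root2 -ik eqxx gtn_eqF // sub0r chiN chi1.
by rewrite !mulr_scalar_mx scalerA -exprS w3 scale1r.
Qed.

End Sites.

Lemma central_scalar_mx m (a : K) (A : 'M[K]_m) : a%:M * A = A * a%:M.
Proof. exact/esym/scalar_mxC. Qed.

(** * Traces against operators at the last sites *)

Section TraceVanishing.
Variable m : nat.
Implicit Types A M Z : 'M[K]_m.

(** Conjugation by [Z] preserves the trace, fixes [A] and multiplies [M] by [a], so the trace equals
    [a] times itself. *)
Lemma trace_twisted A M Z a : Z ^+ 3 = 1 -> Z * A = A * Z ->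
  Z * M = a%:M * (M * Z) -> a != 1 -> \tr (A * M) = 0.
Proof.
move=> Z3 ZA ZM a1.
have [Y [YZ ZY]] : exists Y, Y * Z = 1 /\ Z * Y = 1.
  by exists (Z ^+ 2); rewrite -exprS -exprSr.
have trC (x y : 'M[K]_m) : \tr (x * y) = \tr (y * x) := mxtrace_mulC x y.
suff E : \tr (A * M) = a * \tr (A * M).
  apply/eqP; move/eqP: E; rewrite -subr_eq0 -{1}[\tr _]mul1r -mulrBl mulf_eq0.
  by rewrite subr_eq0 eq_sym (negbTE a1).
rewrite -{1}[A]mul1r -YZ -(mulrA Y) ZA -!mulrA ZM (mulrA A) -central_scalar_mx.
rewrite -(mulrA a%:M) (mulrA Y) -central_scalar_mx -(mulrA a%:M) mulr_scalar_mx
  mxtraceZ.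
by rewrite trC -!mulrA ZY mulr1.
Qed.

(** M^2 is twisted by a^2, so [trace_twisted] removes both nonconstant terms. *)
Lemma trace_tri A M Z b c d a : Z ^+ 3 = 1 -> Z * A = A * Z ->
  Z * M = a%:M * (M * Z) -> a != 1 -> a ^+ 2 != 1 ->
  \tr (A * tri scalar_mx b c d M) = b * \tr A.
Proof.
move=> Z3 ZA ZM a1 aa1.
have ZMM : Z * M ^+ 2 = (a ^+ 2)%:M * (M ^+ 2 * Z).
  rewrite !expr2 mulrA ZM -!mulrA ZM (mulrA M) -central_scalar_mx -!mulrA.
  by rewrite mulrA -rmorphM.
rewrite /tri !mulrDr !mxtraceD -central_scalar_mx mulr_scalar_mx mxtraceZ.
rewrite !mulr_scalar_mx -![A * (_ *: _)]scalemxAr !mxtraceZ.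
rewrite -![A *m _]/(A * _).
by rewrite (trace_twisted Z3 ZA ZM a1) (trace_twisted Z3 ZA ZMM aa1) !mulr0
  !addr0.
Qed.

End TraceVanishing.

Section LastSite.
Variables (n : nat) (s : 'I_n).
Local Notation X := {ffun 'I_n -> 'F_3}.
Implicit Types i k : 'I_n.-1.

(** The generalized Pauli operators at the site [s]. At the last site they serve as [Z] in
    [trace_tri]: the clock detects U and the shift detects P. *)
Definition site_clock : endmx K X := mon (fun x : X => chi (x s)) id.
Definition site_unit : X := [ffun k => (k == s)%:R].
Definition site_shift : endmx K X := mon (fun=> 1) (fun x : X => x + site_unit).

Lemma site_clock_cube : site_clock ^+ 3 = 1.
Proof.
rewrite !exprS expr0 mulr1 !monM -mon1; apply: eq_mon => [x|//] /=.
by rewrite -mulrA -!expr2 -exprS chi_cube.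
Qed.

Lemma site_shift_cube : site_shift ^+ 3 = 1.
Proof.
have u3 : site_unit + (site_unit + site_unit) = 0.
  by apply/ffunP=> k; rewrite !ffunE; case: (k == s);
    [exact: val_inj | rewrite !addr0].
rewrite !exprS expr0 mulr1 !monM -mon1; apply: eq_mon => [x|x] /=;
  first by rewrite !mul1r.
by rewrite -!addrA u3 addr0.
Qed.

Lemma site_clock_Uop i : site_clock * Uop i =
  (chi (root2 i s))%:M * (Uop i * site_clock).
Proof.
rewrite UopE !monM mulr_scalar_mx mon_scale; apply: eq_mon => // x /=.
by rewrite [in LHS]ffunE chiD mulrA mulrC (mulrC w).
Qed.

Lemma site_clock_Pop i : site_clock * Pop i = Pop i * site_clock.
Proof. by rewrite PopE !monM; apply: eq_mon => // x /=; rewrite mulrC. Qed.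

Lemma site_shift_Uop i : site_shift * Uop i = Uop i * site_shift.
Proof.
by rewrite UopE !monM; apply: eq_mon => x /=; [rewrite mulrC | rewrite addrAC].
Qed.

Lemma site_shift_Pop i :
  Pop i * site_shift = (chi (pair_sum i site_unit))%:M * (site_shift * Pop i).
Proof.
rewrite PopE !monM mulr_scalar_mx mon_scale; apply: eq_mon => // x /=.
by rewrite pair_sumD addrA chiD mul1r mulr1 mulrC.
Qed.

End LastSite.

Section AddSite.
Variable n : nat.
Local Notation X := {ffun 'I_n -> 'F_3}.
Local Notation X1 := {ffun 'I_n.+1 -> 'F_3}.

Definition ffext (z : 'F_3) (x : X) : X1 := [ffun k =>
  oapp x z (unlift ord_max k)].
Definition ffres (x : X1) : X := [ffun k => x (lift ord_max k)].

Lemma ffextE z x (k : 'I_n.+1) (k' : 'I_n) : k = k' :> nat ->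
  ffext z x k = x k'.
Proof.
move=> kk; have -> : k = lift ord_max k' by apply: val_inj;
  rewrite [RHS]lift_max.
by rewrite ffunE liftK.
Qed.

Lemma ffext_last z x : ffext z x ord_max = z.
Proof. by rewrite ffunE unlift_none. Qed.

Lemma ffextK z x : ffres (ffext z x) = x.
Proof. by apply/ffunP=> k; rewrite ffunE; apply: ffextE; exact: lift_max. Qed.

Lemma ffresK (x : X1) : ffext (x ord_max) (ffres x) = x.
Proof. by apply/ffunP=> k; rewrite ffunE; case: unliftP => [k'|] -> //=;
  rewrite ffunE. Qed.

(** The embedding v -> v (x) e_z and its left inverse. Intertwining A with A' through [ext_op z] for
    all z expresses A = A' (x) I. *)
Definition ext_op z := mon (fun=> 1) (ffext z).
Definition res_op z := mon (fun x : X1 => (x ord_max == z)%:R) ffres.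

Lemma ext_opK z : res_op z *m ext_op z = 1%:M.
Proof.
rewrite mon_mul -mon_id; apply: eq_mon => x /=; last exact: ffextK.
by rewrite ffext_last eqxx mulr1.
Qed.

Lemma sum_ext_res : \sum_z ext_op z *m res_op z = 1%:M.
Proof.
apply/matrixP=> a b; rewrite summxE (bigD1 (enum_val b ord_max)) //=.
rewrite mon_mul !mxE eqxx mulr1 mul1r /= ffresK (inj_eq enum_val_inj).
rewrite big1 ?addr0 // => z zb; rewrite mon_mul !mxE eq_sym (negbTE zb).
by rewrite !mul0r.
Qed.

(** The resolution of the identity [sum_ext_res] splits the trace into three blocks, each with the
    trace of [A']. *)
Lemma trace_ext (A : endmx K X1) (A' : endmx K X) :
  (forall z, A *m ext_op z = ext_op z *m A') -> \tr A = 3 * \tr A'.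
Proof.
move=> AJ; rewrite -[A]mulmx1 -sum_ext_res mulmx_sumr linear_sum /=.
rewrite (eq_bigr (fun=> \tr A')) => [|z _].
  by rewrite sumr_const card_Fp // mulr_natl.
by rewrite mulmxA AJ -mulmxA mxtrace_mulC -mulmxA ext_opK mulmx1.
Qed.

Lemma ext_op_eq0 (A : endmx K X1) (A' : endmx K X) :
  (forall z, A *m ext_op z = ext_op z *m A') -> A' = 0 -> A = 0.
Proof.
move=> AJ A0; rewrite -[A]mulmx1 -sum_ext_res mulmx_sumr big1 // => z _.
by rewrite mulmxA AJ A0 mulmx0 mul0mx.
Qed.

Lemma root2_widen_last (i : 'I_n.-1) :
  root2 (n := n.+1) (widen_ord (leq_pred n) i) ord_max = 0.
Proof.
have i1n := ltn_ord (snd_factor i).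
rewrite ffunE -!(inj_eq val_inj) /= !gtn_eqF ?subrr //.
exact: ltn_trans i1n.
Qed.

Lemma root2_widen_lift (i : 'I_n.-1) k :
  root2 (n := n.+1) (widen_ord (leq_pred n) i) (lift ord_max k) = root2 i k.
Proof. by rewrite !ffunE -!(inj_eq val_inj) [val (lift _ _)]lift_max. Qed.

Lemma Uop_ext (i : 'I_n.-1) z :
  Uop (n := n.+1) (widen_ord (leq_pred n) i) *m ext_op z = ext_op z *m Uop i.
Proof.
rewrite !UopE !mon_mul; apply: eq_mon => x /=; first by rewrite mulrC.
apply/ffunP=> k; rewrite [LHS]ffunE; case: (unliftP ord_max k) => [k'|] ->.
  by rewrite !(ffextE _ _ (lift_max k')) root2_widen_lift [RHS]ffunE.
by rewrite !ffext_last root2_widen_last addr0.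
Qed.

Lemma Pop_ext (i : 'I_n.-1) z :
  Pop (n := n.+1) (widen_ord (leq_pred n) i) *m ext_op z = ext_op z *m Pop i.
Proof.
rewrite !PopE !mon_mul; apply: eq_mon => x //=; rewrite mul1r mulr1 /pair_sum.
by congr (chi (1 + (_ + _))); apply: ffextE.
Qed.

Lemma site_clock_widen (i : 'I_n.-1) (k :=
  widen_ord (leq_pred n) i : 'I_n.+1.-1) :
  site_clock ord_max * Uop k = Uop k * site_clock ord_max.
Proof. by rewrite site_clock_Uop root2_widen_last mulr_scalar_mx scale1r. Qed.

Lemma site_shift_widen (i : 'I_n.-1) (k :=
  widen_ord (leq_pred n) i : 'I_n.+1.-1) :
  site_shift ord_max * Pop k = Pop k * site_shift ord_max.
Proof.
have i1n := ltn_ord (snd_factor i).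
rewrite site_shift_Pop (_ : pair_sum _ _ = 0) ?mulr_scalar_mx ?scale1r //.
rewrite /pair_sum !ffunE -!(inj_eq val_inj) /= !ltn_eqF ?addr0 //.
exact: ltn_trans i1n.
Qed.

End AddSite.

Section LastPair.
Variable n : nat.
Local Notation k := (ord_max : 'I_n.+2.-1).

Lemma site_clock_last : site_clock ord_max * Uop k =
  (w ^+ 2)%:M * (Uop k * site_clock ord_max).
Proof.
rewrite site_clock_Uop (_ : root2 _ _ = -1) ?chiN ?chi1 //.
by rewrite ffunE -!(inj_eq val_inj) /= eqxx gtn_eqF // sub0r.
Qed.

Lemma site_shift_last :
  site_shift ord_max * Pop k = (w ^+ 2)%:M * (Pop k * site_shift ord_max).
Proof.
rewrite site_shift_Pop (_ : pair_sum _ _ = 1).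
  by rewrite chi1 !mulr_scalar_mx scalerA -exprSr w3 scale1r.
by rewrite /pair_sum !ffunE -!(inj_eq val_inj) /= eqxx ltn_eqF // add0r.
Qed.

(** The clock commutes with [A] and P, so it strips off U first; the shift then strips off P. *)
Lemma trace_last A a b : w ^+ 2 != 1 -> w != 1 ->
  site_clock ord_max * A = A * site_clock ord_max ->
  site_shift ord_max * A = A * site_shift ord_max ->
  \tr (A * (quad scalar_mx a (Pop k) * quad scalar_mx b (Uop k))) = \tr A.
Proof.
move=> ww1 w1 ZA SA; have w41 : (w ^+ 2) ^+ 2 != 1 by rewrite -exprM
  (exprD w 3 1) w3 mul1r.
rewrite mulrA (trace_tri _ _ _ (site_clock_cube _) _ site_clock_last) //.
  by rewrite mul1r (trace_tri _ _ _ (site_shift_cube _) _ site_shift_last) //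
    mul1r.
rewrite mulrA ZA -!mulrA; congr (_ * _); apply/esym/tri_comm;
  first exact: central_scalar_mx.
by rewrite site_clock_Pop.
Qed.

End LastPair.
End Cyclic.

End MonomialOperators.

(** * The representation and its trace *)

Section Adjoint.
Variable C : numClosedFieldType.

Definition adj m (A : 'M[C]_m) : 'M[C]_m := map_mx Num.conj A^T.

Lemma adjD m (A B : 'M[C]_m) : adj (A + B) = adj A + adj B.
Proof. by rewrite /adj linearD map_mxD. Qed.

Lemma adjM m (A B : 'M[C]_m) : adj (A * B) = adj B * adj A.
Proof. by rewrite /adj -[A * B]/(A *m B) trmx_mul map_mxM. Qed.

Lemma adj_scalar m (a : C) : adj a%:M = (a^*)%:M :> 'M_m.
Proof. by rewrite /adj tr_scalar_mx map_scalar_mx. Qed.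

Lemma adj_tri m a b c (A : 'M[C]_m) :
  adj (tri scalar_mx a b c A) = tri scalar_mx a^* b^* c^* (adj A).
Proof.
have -> : tri scalar_mx a b c A =
  a%:M + b%:M * A + c%:M * (A * A) by rewrite /tri expr2.
rewrite !adjD !adjM !adj_scalar /tri expr2.
by rewrite -!central_scalar_mx.
Qed.

(** The trace is the sum of the squared moduli of all entries. *)
Lemma trace_adj_eq0 m (A : 'M[C]_m) : \tr (A * adj A) = 0 -> A = 0.
Proof.
move=> trA; apply/matrixP=> i k; rewrite mxE.
have E l : (A *m adj A) l l = \sum_h A l h * (A l h)^*.
  by rewrite mxE; apply: eq_bigr => h _; rewrite !mxE.
have pos l : 0 <= (A *m adj A) l l by rewrite E; apply: sumr_ge0 => h _;
  exact: mul_conjC_ge0.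
have /psumr_eq0P := trA => /(_ (fun l _ => pos l)) /(_ i isT); rewrite E.
move/psumr_eq0P => /(_ (fun h _ => mul_conjC_ge0 _)) /(_ k isT) /eqP.
by rewrite mul_conjC_eq0 => /eqP.
Qed.

Lemma adj_mon (X : finType) (c : X -> C) (s t : X -> X) : cancel s t ->
  cancel t s ->
  adj (mon c s) = mon (fun x => (c (t x))^*) t.
Proof.
move=> st ts; apply/matrixP=> a b; rewrite !mxE rmorphM rmorph_nat.
rewrite [in LHS]eq_sym (can2_eq st ts); case: eqP => [<-|_];
  last by rewrite !mulr0.
by rewrite !mulr1.
Qed.

Lemma conj_cube_root (w : C) : w ^+ 3 = 1 -> w^* = w ^+ 2.
Proof.
move=> w3; have w0 : w != 0 by apply: contra_eq_neq w3 => ->;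
  rewrite expr0n eq_sym oner_eq0.
have nw : `|w| = 1.
  by apply/eqP; rewrite -(@pexpr_eq1 _ _ 3) // -normrX w3 normr1.
by apply: (mulfI w0); rewrite -normCK nw expr1n -exprS w3.
Qed.

Lemma conj_sqr_N1 (j : C) : j ^+ 2 = -1 -> j^* = - j.
Proof.
move=> j2; have j0 : j != 0 by apply: contra_eq_neq j2 => ->;
  rewrite expr0n eq_sym oppr_eq0 oner_eq0.
have nj : `|j| = 1.
  by apply/eqP; rewrite -(@pexpr_eq1 _ _ 2) // -normrX j2 normrN normr1.
by apply: (mulfI j0); rewrite -normCK nj expr1n mulrN -expr2 j2 opprK.
Qed.

End Adjoint.

Section BMWRepresentation.
Variables (C : numClosedFieldType) (w q j : C).
Hypotheses (w_root : 1 + w + w ^+ 2 = 0) (j2 : j ^+ 2 = - 1).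
Hypothesis q_diff : q - q^-1 = j.

Let C3 : 3 != 0 :> C. Proof. by rewrite pnatr_eq0. Qed.
Let w3 := cube_root_cube w_root.

Let w1 : w != 1.
Proof.
apply: contraNneq C3 => w1; rewrite -w_root w1 expr1n.
by apply/eqP; ring.
Qed.

Let ww1 : w ^+ 2 != 1.
Proof.
apply: contraNneq C3 => w21; have := cube_root_sqr_root w_root;
  rewrite w21 expr1n => <-.
by apply/eqP; ring.
Qed.

Local Notation G n := (heis_gen scalar_mx w j (Uop w (n := n)) (Pop w
  (n := n))).

Lemma rep_rel n s t : bmw_rel j q s t ->
  alg_eval (scalar_mx : {rmorphism C -> endmx C {ffun 'I_n -> 'F_3}}) (G n) s =
  alg_eval (scalar_mx : {rmorphism C -> endmx C {ffun 'I_n -> 'F_3}}) (G n) t.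
Proof.
apply: (heis_rel (@central_scalar_mx _ _) w_root j2 C3 q_diff).
- exact: Uop_cube.
- exact: Pop_cube.
- exact: UopC.
- exact: PopC.
- exact: Uop_Pop_far.
- exact: Uop_Pop_next.
- exact: Pop_Uop_next.
Qed.

Definition rep n : bmw j q n -> endmx C {ffun 'I_n -> 'F_3} :=
  presented_lift scalar_mx (G n) (rel := @bmw_rel C j q n).

Fact rep_is_nmod_morphism n : nmod_morphism (@rep n).
Proof.
split; last exact: (presented_liftD (@central_scalar_mx _ _) (@rep_rel n)).
by rewrite [LHS](presented_liftE (@central_scalar_mx _ _) (@rep_rel n)) /=
  rmorph0.
Qed.

Fact rep_is_monoid_morphism n : monoid_morphism (@rep n).
Proof.
split; first exact: (presented_lift1 (@central_scalar_mx _ _) (@rep_rel n)).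
exact: (presented_liftM (@central_scalar_mx _ _) (@rep_rel n)).
Qed.

Fact rep_is_scalable n : scalable (@rep n).
Proof.
move=> a x; rewrite [LHS](presented_liftZ (@central_scalar_mx _ _)
  (@rep_rel n)).
exact: mul_scalar_mx.
Qed.

HB.instance Definition _ n := GRing.isNmodMorphism.Build (bmw j q n)
  (endmx C {ffun 'I_n -> 'F_3}) (@rep n) (@rep_is_nmod_morphism n).
HB.instance Definition _ n := GRing.isMonoidMorphism.Build (bmw j q n)
  (endmx C {ffun 'I_n -> 'F_3}) (@rep n) (@rep_is_monoid_morphism n).
HB.instance Definition _ n := GRing.isScalable.Build C (bmw j q n)
  (endmx C {ffun 'I_n -> 'F_3}) *:%R (@rep n) (@rep_is_scalable n).

Definition rep_lrmorphism n :
  {lrmorphism bmw j q n -> endmx C {ffun 'I_n -> 'F_3}} := @rep n.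

Lemma rep_gen n x : rep (pgen (@bmw_rel C j q n) x) = G n x.
Proof. exact: (presented_lift_gen (@central_scalar_mx _ _) (@rep_rel n)). Qed.

Let rep_g n i : rep (bmw_g j q i) =
  hg scalar_mx w j (Uop w i) (Pop w i) :> endmx C {ffun 'I_n -> 'F_3}.
Proof. exact: rep_gen. Qed.

Let rep_gV n i : rep (bmw_gV j q i) =
  hgV scalar_mx w j (Uop w i) (Pop w i) :> endmx C {ffun 'I_n -> 'F_3}.
Proof. exact: rep_gen. Qed.

Let rep_e n i : rep (bmw_e j q i) =
  he scalar_mx (Uop w i) (Pop w i) :> endmx C {ffun 'I_n -> 'F_3}.
Proof. exact: rep_gen. Qed.

Section Adjoints.
Variable n : nat.

Lemma adj_Uop (i : 'I_n.-1) : adj (Uop w i) = Uop w i ^+ 2.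
Proof.
have add2 := addrK (root2 i); have sub2 := subrK (root2 i).
rewrite UopE (adj_mon _ add2 sub2) expr2 monM; apply: eq_mon => x /=.
  by rewrite conj_cube_root // expr2.
apply/ffunP=> k; rewrite !ffunE -addrA; congr (_ + _).
(* The square of U translates by twice the root, which over F_3 is the inverse translation. *)
have F a : a + a = - a :> 'F_3.
  by apply/eqP; rewrite -subr_eq0 opprK -mulr2n -mulrSr; apply/eqP/val_inj;
    case: a => [[|[|[|]]]].
by rewrite F.
Qed.

Lemma adj_Pop (i : 'I_n.-1) : adj (Pop w i) = Pop w i ^+ 2.
Proof.
rewrite PopE (adj_mon _ (fun=> erefl) (fun=> erefl)) expr2 monM;
  apply: eq_mon => // x /=.
by rewrite conj_cube_root ?chi_cube // expr2.
Qed.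

(** The adjoint of P or U is its square, which [quad_sqr] absorbs, and the two factors commute; so
    only the scalars get conjugated. *)
Lemma adj_pair a b c (i : 'I_n.-1) :
  adj (c%:M * (quad scalar_mx a (Pop w i) * quad scalar_mx b (Uop w i))) =
  (c^*)%:M * (quad scalar_mx a^* (Pop w i) * quad scalar_mx b^* (Uop w i)).
Proof.
have adj_quad x (A : endmx C {ffun 'I_n -> 'F_3}) : A ^+ 3 = 1 ->
  adj A = A ^+ 2 ->
    adj (quad scalar_mx x A) = quad scalar_mx x^* A.
  by move=> A3 AE; rewrite adj_tri AE rmorph1; exact: quad_sqr.
have adj_prod x (A B : endmx C {ffun 'I_n -> 'F_3}) :
    adj (x%:M * (A * B)) = (x^*)%:M * (adj B * adj A).
  by rewrite adjM (adj_scalar _ x) adjM central_scalar_mx.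
rewrite adj_prod; transitivity ((c^*)%:M *
    (quad scalar_mx b^* (Uop w i) * quad scalar_mx a^* (Pop w i))).
  congr (_ * (_ * _)); first exact: (adj_quad _ _ (Uop_cube w3 i) (adj_Uop i)).
  exact: (adj_quad _ _ (Pop_cube w3 i) (adj_Pop i)).
have UP := Uop_Pop_far w3 (not_adjacentxx i).
exact: (congr1 (fun X => (c^*)%:M * X) (quad_commute (@central_scalar_mx _ _)
  b^* a^* UP)).
Qed.

(** Conjugation sends j to -j and w to w^2, so the adjoint exchanges the images of g_i and g_i^-1
    and fixes that of e_i. Sums and reversed products then give all of the image. *)
Lemma rep_adj (a : bmw j q n) : exists b : bmw j q n, rep b = adj (rep a).
Proof.
have w2c : (w ^+ 2)^* = w by rewrite conj_cube_root -?exprM ?(exprD w 3 1) ?w3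
  ?mul1r // (exprM w 3 2) w3 expr1n.
have c3 : (3^-1 : C)^* = 3^-1 by rewrite fmorphV rmorph_nat.
elim/bmw_ind: a => [i|i|i|a|x y [x' xE] [y' yE]|x y [x' xE] [y' yE]].
- exists (bmw_gV j q i); rewrite rep_g rep_gV /hg adj_pair.
  by rewrite rmorphM /= c3 conj_sqr_N1 // conj_cube_root.
- exists (bmw_g j q i); rewrite rep_g rep_gV /hgV adj_pair.
  by rewrite rmorphM rmorphN /= c3 conj_sqr_N1 // opprK w2c.
- by exists (bmw_e j q i); rewrite rep_e /he adj_pair c3 rmorph1.
- exists (a^*)%:A; rewrite !linearZ !rmorph1 /=.
  have s1 x : x *: (1 : endmx C {ffun 'I_n -> 'F_3}) = x%:M by exact: scalemx1.
  by rewrite !s1 adj_scalar.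
- by exists (x' + y'); rewrite !rmorphD /= xE yE adjD.
- by exists (y' * x'); rewrite !rmorphM /= xE yE adjM.
Qed.

Definition rep_trace (a : bmw j q n) : C := (3 ^+ n)^-1 * \tr (rep a).

Fact rep_trace_scalar : scalar rep_trace.
Proof.
move=> c a b; rewrite /rep_trace linearP /= mxtraceD mxtraceZ mulrDr.
by rewrite mulrCA.
Qed.

HB.instance Definition _ := GRing.isLinear.Build C (bmw j q n) C *%R rep_trace
  rep_trace_scalar.

Lemma rep_trace1 : rep_trace 1 = 1.
Proof.
rewrite /rep_trace rmorph1 mxtrace1 card_ffun card_Fp // card_ord natrX.
by rewrite mulVf // expf_neq0.
Qed.

Lemma rep_traceC a b : rep_trace (a * b) = rep_trace (b * a).
Proof. by rewrite /rep_trace !rmorphM; congr (_ * _); exact: mxtrace_mulC. Qed.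

Definition rep_normalized_trace := NormalizedTrace rep_trace1 rep_traceC.

(** Testing [a] against a [b] whose image is the adjoint of that of [a] makes positivity
    applicable. *)
Lemma rep_trace_radical (a : bmw j q n) :
  (forall b, rep_trace (a * b) = 0) <-> rep a = 0.
Proof.
split=> [ra|a0 b]; last by rewrite /rep_trace rmorphM /= a0 mul0r mxtrace0
  mulr0.
have [b bE] := rep_adj a; apply: trace_adj_eq0; rewrite -bE -rmorphM.
by apply/eqP; have /eqP := ra b;
  rewrite mulf_eq0 invr_eq0 expf_eq0 (negbTE C3) andbF.
Qed.

End Adjoints.

Section Markov.
Variable n : nat.

(** Adding a strand tensors the image with the identity of the new factor. The relation [I] is
    stable under sums and products and holds for scalars, so checking U and P suffices. *)
Lemma rep_incl (a : bmw j q n) z :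
  rep (bmw_incl a) *m ext_op C n z = ext_op C n z *m rep a.
Proof.
pose I (A : endmx C {ffun 'I_n.+1 -> 'F_3}) (A' : endmx C {ffun 'I_n -> 'F_3})
  :=
  A *m ext_op C n z = ext_op C n z *m A'.
have ID A A' B B' : I A A' -> I B B' -> I (A + B) (A' + B').
  by rewrite /I mulmxDl mulmxDr => -> ->.
have IM A A' B B' : I A A' -> I B B' -> I (A * B) (A' * B').
  by rewrite /I -mulmxA => IA ->; rewrite mulmxA IA -mulmxA.
have Ic c : I c%:M c%:M by rewrite /I mul_scalar_mx mul_mx_scalar.
have Itri a1 b c A A' : I A A' ->
  I (tri scalar_mx a1 b c A) (tri scalar_mx a1 b c A').
  by move=> IA; rewrite /tri !expr2;
    exact: (ID _ _ _ _ (ID _ _ _ _ (Ic a1) (IM _ _ _ _ (Ic b) IA)) (IM _ _ _ _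
    (Ic c) (IM _ _ _ _ IA IA))).
have Ipair c a1 b i (k := widen_ord (leq_pred n) i : 'I_n.+1.-1) :
    I (c%:M * (quad scalar_mx a1 (Pop w k) * quad scalar_mx b (Uop w k)))
      (c%:M * (quad scalar_mx a1 (Pop w i) * quad scalar_mx b (Uop w i))).
  have IU := Uop_ext w i z; have IP := Pop_ext w i z.
  exact: (IM _ _ _ _ (Ic c) (IM _ _ _ _ (Itri _ _ _ _ _ IP)
    (Itri _ _ _ _ _ IU))).
elim/bmw_ind: a => [i|i|i|c|x y Ix Iy|x y Ix Iy].
- by rewrite bmw_incl_g !rep_g; exact: Ipair.
- by rewrite bmw_incl_gV !rep_gV; exact: Ipair.
- by rewrite bmw_incl_e !rep_e; exact: Ipair.
- have s1 m x : x *: (1 : 'M[C]_m) = x%:M by exact: scalemx1.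
  by rewrite !(linearZ, rmorph1) /= !s1 mul_scalar_mx mulmx1.
- by rewrite !rmorphD; exact: ID.
- by rewrite !rmorphM; exact: IM.
Qed.

Lemma rep_incl_eq0 (a : bmw j q n) : rep a = 0 -> rep (bmw_incl a) = 0.
Proof. by apply: ext_op_eq0 => z; exact: rep_incl. Qed.

End Markov.

Lemma rep_incl_clock n (a : bmw j q n) :
  site_clock w ord_max * rep (bmw_incl a) =
    rep (bmw_incl a) * site_clock w ord_max /\
  site_shift C ord_max * rep (bmw_incl a) =
    rep (bmw_incl a) * site_shift C ord_max.
Proof.
pose I (A : endmx C {ffun 'I_n.+1 -> 'F_3}) :=
  GRing.comm (site_clock w ord_max) A /\ GRing.comm (site_shift C ord_max) A.
have IM A B : I A -> I B -> I (A * B) by case=> ? ? [? ?]; split; apply: commrM.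
have ID A B : I A -> I B -> I (A + B) by case=> ? ? [? ?]; split; apply: commrD.
have Ic c : I c%:M by split; exact/esym/central_scalar_mx.
have Itri a1 b c A : I A -> I (tri scalar_mx a1 b c A).
  by move=> IA; rewrite /tri !expr2;
    exact: (ID _ _ (ID _ _ (Ic a1) (IM _ _ (Ic b) IA)) (IM _ _ (Ic c)
    (IM _ _ IA IA))).
have IU (i : 'I_n.-1) : I (Uop w (n := n.+1) (widen_ord (leq_pred n) i)).
  by split; [exact: site_clock_widen | exact: site_shift_Uop].
have IP (i : 'I_n.-1) : I (Pop w (n := n.+1) (widen_ord (leq_pred n) i)).
  by split; [exact: site_clock_Pop | exact: site_shift_widen].
have Ipair c a1 b (i : 'I_n.-1) (k := widen_ord (leq_pred n) i : 'I_n.+1.-1) :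
    I (c%:M * (quad scalar_mx a1 (Pop w k) * quad scalar_mx b (Uop w k))).
  exact: (IM _ _ (Ic c) (IM _ _ (Itri _ _ _ _ (IP i)) (Itri _ _ _ _ (IU i)))).
elim/bmw_ind: a => [i|i|i|c|x y Ix Iy|x y Ix Iy].
- by rewrite bmw_incl_g rep_g; exact: Ipair.
- by rewrite bmw_incl_gV rep_gV; exact: Ipair.
- by rewrite bmw_incl_e rep_e; exact: Ipair.
- have s1 m x : x *: (1 : 'M[C]_m) = x%:M by exact: scalemx1.
  by rewrite !(linearZ, rmorph1) /= !s1; exact: Ic.
- by rewrite !rmorphD; exact: ID.
- by rewrite !rmorphM; exact: IM.
Qed.

(** By [trace_last] the last generator contributes only its scalar prefactor: j/3, -j/3 = j^-1/3 or
    1/3. The factor 3 from [trace_ext] matches the change of normalization. *)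
Lemma rep_trace_markov n (a : bmw j q n.+1) :
  [/\ rep_trace (bmw_incl a * bmw_g j q (n := n.+2) ord_max) =
    j / 3 * rep_trace a,
      rep_trace (bmw_incl a * bmw_gV j q (n := n.+2) ord_max) =
        j^-1 / 3 * rep_trace a
    & rep_trace (bmw_incl a * bmw_e j q (n := n.+2) ord_max) =
      3^-1 * rep_trace a].
Proof.
have [Z S] := rep_incl_clock a.
have tr3 : \tr (rep (bmw_incl a)) = 3 * \tr (rep a) by apply: trace_ext => z;
  exact: rep_incl.
have key c a1 b (k := ord_max : 'I_n.+2.-1) :
    (3 ^+ n.+2)^-1 * \tr (rep (bmw_incl a) *
    (c%:M * (quad scalar_mx a1 (Pop w k) * quad scalar_mx b (Uop w k)))) =
    c * rep_trace a.
  rewrite /k iotaCA /=; last exact: central_scalar_mx.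
  rewrite mulr_scalar_mx mxtraceZ.
  rewrite (trace_last w3 a1 b ww1 w1 Z S) tr3 /rep_trace mulrCA; congr (_ * _).
  by rewrite mulrA; congr (_ * _);
    rewrite (exprS _ n.+1) invfM mulrAC mulVf ?mul1r.
have jV : j^-1 = - j.
  have j0 : j != 0 by apply: contra_eq_neq j2 => ->;
    rewrite expr0n eq_sym oppr_eq0 oner_eq0.
  by field: j2.
by split; rewrite {1}/rep_trace rmorphM /= ?rep_g ?rep_gV ?rep_e key // jV.
Qed.

End BMWRepresentation.

(** * Trace quotients *)

Section MarkovUniqueness.
Variables (K : fieldType) (r q : K).
Hypotheses (r0 : r != 0) (qq0 : q - q^-1 != 0).
Variables (x y z : K) (tr tr' : forall n, normalized_trace (bmw r q n)).

Definition markov_with (t : forall n, normalized_trace (bmw r q n)) : Prop :=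
  forall n (a : bmw r q n.+1),
  [/\ t n.+2 (bmw_incl a * bmw_g r q (n := n.+2) ord_max) = x * t n.+1 a,
      t n.+2 (bmw_incl a * bmw_gV r q (n := n.+2) ord_max) = y * t n.+1 a
    & t n.+2 (bmw_incl a * bmw_e r q (n := n.+2) ord_max) = z * t n.+1 a].

(** The skein relation writes 1 as e + (q - q^-1)^-1 (g - g^-1), so the three Markov conditions
    determine the trace of an included element. *)
Lemma markov_incl t n (a : bmw r q n.+1) : markov_with t ->
  t n.+2 (bmw_incl a) = (z + (q - q^-1)^-1 * (x - y)) * t n.+1 a.
Proof.
move=> /(_ n a) [tg tgV te].
have -> : bmw_incl a = bmw_incl a * bmw_e r q (n := n.+2) ord_max +
    (q - q^-1)^-1 *: (bmw_incl a * bmw_g r q (n := n.+2) ord_max -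
                      bmw_incl a * bmw_gV r q (n := n.+2) ord_max).
  by rewrite -mulrBr bmw_skein scalerAr scalerA mulVf // scale1r -mulrDr addrC
    subrK mulr1.
by rewrite linearD linearZ /= linearB /= tg tgV te; ring.
Qed.

(** On at most one strand the algebra consists of scalars. Above that, [spanned_all] applies:
    cyclicity turns a g b into (b a) g, and likewise for e, where the Markov conditions reduce to
    fewer strands. *)
Lemma markov_unique : markov_with tr -> markov_with tr' ->
  forall n a, tr n a = tr' n a.
Proof.
move=> m m' n; elim: n => [|[|n] IHn] a.
- by have [c ->] := bmw_small a isT; rewrite !linearZ /= !ntrace1.
- by have [c ->] := bmw_small a isT; rewrite !linearZ /= !ntrace1.
elim: {a}(spanned_all r0 qq0 a) => [a|a b|a b|u v _ IHu _ IHv].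
- by rewrite !markov_incl // IHn.
- rewrite [LHS]ntraceC [RHS]ntraceC !mulrA -!rmorphM /=.
  by have [-> _ _] := m n (b * a); have [-> _ _] := m' n (b * a); rewrite IHn.
- rewrite [LHS]ntraceC [RHS]ntraceC !mulrA -!rmorphM /=.
  by have [_ _ ->] := m n (b * a); have [_ _ ->] := m' n (b * a); rewrite IHn.
- by rewrite !linearD /= IHu IHv.
Qed.

End MarkovUniqueness.

Section QuotientLift.
Variables (K : fieldType) (A : algType K) (tr : normalized_trace A).
Variables (B : pzRingType) (s : K -> B -> B) (f : {lrmorphism A -> B | s}).
Hypothesis f0 : forall a, trace_radical tr a -> f a = 0.

Definition quotient_lift (x : trace_quotient tr) : B := f (repr x).

Lemma quotient_liftE a : quotient_lift (tclass tr a) = f a.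
Proof.
by apply/eqP; rewrite -subr_eq0 -rmorphB; apply/eqP/f0/repr_tclass.
Qed.

Fact quotient_lift_is_nmod_morphism : nmod_morphism quotient_lift.
Proof.
split=> [|]; first by rewrite quotient_liftE rmorph0.
by elim/tclass_ind=> a; elim/tclass_ind=> b;
  rewrite -rmorphD !quotient_liftE rmorphD.
Qed.

Fact quotient_lift_is_monoid_morphism : monoid_morphism quotient_lift.
Proof.
split=> [|]; first by rewrite quotient_liftE rmorph1.
by elim/tclass_ind=> a; elim/tclass_ind=> b;
  rewrite -rmorphM !quotient_liftE rmorphM.
Qed.

Fact quotient_lift_is_scalable : scalable_for s quotient_lift.
Proof.
by move=> c; elim/tclass_ind=> a; rewrite -linearZ !quotient_liftE linearZ_LR.
Qed.

HB.instance Definition _ := GRing.isNmodMorphism.Build (trace_quotient tr) B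
  quotient_lift quotient_lift_is_nmod_morphism.
HB.instance Definition _ := GRing.isMonoidMorphism.Build (trace_quotient tr) B
  quotient_lift quotient_lift_is_monoid_morphism.
HB.instance Definition _ := GRing.isScalable.Build K (trace_quotient tr) B s
  quotient_lift quotient_lift_is_scalable.

Lemma quotient_lift_ex : exists g : {lrmorphism trace_quotient tr -> B | s},
  forall a, g (tclass tr a) = f a.
Proof. by exists quotient_lift; exact: quotient_liftE. Qed.

End QuotientLift.

(** * The operator R_3 *)

Section Constants.
Variable R : realType.
Local Notation q := (qB R).
Local Notation w := (omega3 R).
Local Notation j := (rB R).

Lemma expiD (a b : R) : expi (a + b) = expi a * expi b.
Proof.
by rewrite /expi cosD sinD; apply/eqP; rewrite eq_complex; apply/andP; split;
  apply/eqP => /=; ring.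
Qed.

Lemma expi0 : expi 0 = 1 :> R[i].
Proof. by rewrite /expi cos0 sin0. Qed.

Lemma expiMn (a : R) n : expi (a *+ n) = expi a ^+ n.
Proof. by elim: n => [|n IHn]; rewrite ?expi0 // mulrS expiD IHn exprS. Qed.

Lemma rB_sqr : j ^+ 2 = -1.
Proof.
rewrite /rB -exprM /qB -expiMn (_ : pi / 6 *+ (3 * 2) =
  pi) ?/expi ?cospi ?sinpi.
  by apply/eqP; rewrite eq_complex /= oppr0 !eqxx.
by rewrite -mulr_natr; field.
Qed.

Lemma cos_pi6_gt0 : 0 < cos (pi / 6 : R).
Proof. by apply: cos_gt0_pihalf; have := pi_gt0 R; lra. Qed.

(** This is the twelfth cyclotomic polynomial X^4 - X^2 + 1 at q, obtained from q^6 + 1 = 0 by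
    cancelling q^2 + 1. Later identities between constants are computed modulo it. *)
Lemma qB_pow4 : q ^+ 4 = q ^+ 2 - 1.
Proof.
(* The real part is cos (pi/3) + 1 > 0. *)
have q21 : q ^+ 2 + 1 != 0.
  rewrite /qB -expiMn eq_complex /= negb_and; apply/orP; left.
  rewrite gt_eqF // ltr_wpDl //; apply: cos_ge0_pihalf.
  by rewrite -mulr_natr; have := pi_gt0 R; lra.
have q6 : q ^+ 6 = -1 by rewrite -rB_sqr /rB -exprM.
apply/eqP; rewrite -subr_eq0 -(mulrI_eq0 _ (mulfI q21)); apply/eqP.
have -> : (q ^+ 2 + 1) * (q ^+ 4 - (q ^+ 2 - 1)) = q ^+ 6 + 1 by ring.
by rewrite q6 addNr.
Qed.

Lemma omega3E : w = q ^+ 2 - 1.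
Proof.
rewrite -qB_pow4 /qB -expiMn /omega3; congr (expi _).
by rewrite -mulr_natr; field.
Qed.

Lemma omega3_root : 1 + w + w ^+ 2 = 0.
Proof. by rewrite omega3E; ring: qB_pow4. Qed.

Lemma qB_inv : q^-1 = q - q ^+ 3.
Proof.
have qE : q * (q - q ^+ 3) = 1 by ring: qB_pow4.
have q0 : q != 0 by apply: contra_eq_neq qE => ->;
  rewrite mul0r eq_sym oner_eq0.
by apply: (mulfI q0); rewrite qE divff.
Qed.

Lemma qB_diff : q - q^-1 = j.
Proof. by rewrite qB_inv /rB; ring. Qed.

(** Both sides equal q + q^-1 = 2 cos (pi/6): its square is 3 by [qB_pow4], and the cosine is
    positive. *)
Lemma sqrt3E : (Num.sqrt 3)%:C%C = 2 * q - q ^+ 3 :> R[i].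
Proof.
have qV : q^-1 = expi (- (pi / 6)).
  have qN : q * expi (- (pi / 6)) = 1 by rewrite -expiD subrr expi0.
  have q0 : q != 0 by apply: contra_eq_neq qN => ->;
    rewrite mul0r eq_sym oner_eq0.
  by apply: (mulfI q0); rewrite qN divff.
have E : 2 * q - q ^+ 3 = q + q^-1 by rewrite qB_inv; ring.
have cE : q + q^-1 = (2 * cos (pi / 6))%:C%C.
  rewrite qV /qB /expi cosN sinN; apply/eqP;
    rewrite eq_complex /= subrr eqxx andbT.
  by apply/eqP; ring.
rewrite E cE; congr (_ %:C)%C.
have c2 : (2 * cos (pi / 6 : R)) ^+ 2 = 3.
  apply: complexI; rewrite rmorphXn /= -cE qB_inv rmorph_nat.
  by ring: qB_pow4.
by rewrite -c2 sqrtr_sqr ger0_norm // mulr_ge0 // ltW // cos_pi6_gt0.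
Qed.

(** The eigenvalue of Q_w(P) on e_x (x) e_y with x + y = s. *)
Definition R3_coef (s : 'F_3) : R[i] :=
  1 + w * chi w (1 + s) + w * chi w (1 + s) ^+ 2.

(** A quadratic Gauss sum: the Fourier transform of the Gaussian w^(k^2) is again Gaussian in s. It
    is verified for the three values of s. *)
Lemma R3_coefE s : q ^+ 2 * ((Num.sqrt 3)^-1)%:C%C * chi w (s - s ^+ 2) =
  j / 3 * R3_coef s.
Proof.
have s0 : (Num.sqrt 3)%:C%C != 0 :> R[i].
  by rewrite eq_complex /= eqxx andbT sqrtr_eq0 -ltNge ltr0n.
have C3 : 3 != 0 :> R[i] by rewrite pnatr_eq0.
(* Multiplying by 3 sqrt 3 and writing sqrt 3 as 2 q - q^3 leaves a polynomial identity in q. *)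
rewrite fmorphV /=; suff : 3 * q ^+ 2 * chi w (s - s ^+ 2) =
  j * (2 * q - q ^+ 3) * R3_coef s.
  rewrite -sqrt3E; move: (_ %:C)%C s0 => c s0 E.
  apply: (mulfI C3); apply: (mulfI s0).
  transitivity (3 * q ^+ 2 * chi w (s - s ^+ 2)); first by field.
  by rewrite E; field.
have w3 := cube_root_cube omega3_root; have q4 := qB_pow4.
have F3P : s = 0 \/ s = 1 \/ s = -1.
  case: s => [[|[|[|//]]] ?]; [left | right; left | right; right];
    exact: val_inj.
have e0 : 0 - 0 ^+ 2 = 0 :> 'F_3 by exact: val_inj.
have e1 : 1 - 1 ^+ 2 = 0 :> 'F_3 by exact: val_inj.
have e2 : -1 - (-1) ^+ 2 = 1 :> 'F_3 by exact: val_inj.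
have e3 : 1 + 1 = -1 :> 'F_3 by exact: val_inj.
rewrite /R3_coef; case: F3P => [|[]] ->.
- by rewrite e0 addr0 chi0 chi1 omega3E /rB; ring: q4.
- by rewrite e1 e3 chi0 chiN // chi1 omega3E /rB; ring: q4.
- by rewrite e2 subrr chi0 chi1 omega3E /rB; ring: q4.
Qed.

Definition F3_shift (t : 'F_3) (p : 'F_3 * 'F_3) : 'F_3 * 'F_3 :=
  (p.1 + t, p.2 - t).

Lemma R3_sum : R3 R = \sum_(t : 'F_3) mon (fun p => ((Num.sqrt 3)^-1)%:C%C *
  chi w (t ^+ 2 + t - (p.1 + p.2) ^+ 2 + (p.1 + p.2))) (F3_shift t).
Proof.
apply/matrixP=> a b; rewrite summxE !mxE; case bE: (enum_val b) => [x y] /=.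
rewrite mulr_sumr big_mkcond; apply: eq_bigr => t _;
  rewrite mxE bE /F3_shift /=.
by case: eqP => _; rewrite ?mulr1 ?mulr0.
Qed.

Lemma sum_F3 (V : nmodType) (F : 'F_3 -> V) : \sum_t F t =
  F 0 + F 1 + F (1 + 1).
Proof.
rewrite -[LHS]/(\sum_(t < 3) F t) !big_ord_recl big_ord0 addr0 addrA.
by congr (F _ + F _ + F _); exact: val_inj.
Qed.

Lemma quad_scale m a (A : 'M[R[i]]_m) :
  quad scalar_mx a A = 1 + a *: A + a *: A ^+ 2.
Proof. by rewrite /quad /tri rmorph1 -!mulr_scalar_mx. Qed.

(** As U = w T, the coefficients of 1, T, T^2 are 1, w^2 and w^3 = 1, that is, w^(t^2 + t) for t =
    0, 1, 2. *)
Lemma quad_U2_sum : quad scalar_mx w (U2 w) =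
  \sum_(t : 'F_3) mon (fun=> chi w (t ^+ 2 + t)) (F3_shift t).
Proof.
have w3 := cube_root_cube omega3_root; pose f (t : 'F_3) := t ^+ 2 + t.
have f0 : f 0 = 0 by exact: val_inj.
have f1 : f 1 = 1 + 1 by exact: val_inj.
have f2 : f (1 + 1) = 0 by exact: val_inj.
have m0 : mon (fun=> 1) id = mon (fun=> chi w (f 0)) (F3_shift 0).
  by apply: eq_mon => -[x y]; rewrite ?f0 // /F3_shift subr0 addr0.
have m1 : mon (fun=> w * w) shift2 = mon (fun=> chi w (f 1)) (F3_shift 1).
  by apply: eq_mon => // _; rewrite f1 chiD // chi1.
have m2 : mon (fun=> w * (w * w)) (shift2 \o shift2) =
    mon (fun=> chi w (f (1 + 1))) (F3_shift (1 + 1)).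
  apply: eq_mon => [_|p]; first by rewrite f2 chi0 -!expr2 -exprS.
  by rewrite /F3_shift /= /shift2 /= opprD !addrA.
by rewrite sum_F3 -/(f _) -m0 -m1 -m2 quad_scale -mon1 expr2 monM !mon_scale.
Qed.

(** With s = x + y, the exponent of R_3 is (t^2 + t) + (s - s^2), and the shift by t preserves s.
    Thus R_3 factors into a function of U, by [quad_U2_sum], and a diagonal function of P, by
    [R3_coefE]. *)
Lemma G3E : G3 R = hg scalar_mx w j (U2 w) (P2 w).
Proof.
have w3 := cube_root_cube omega3_root.
have -> : hg scalar_mx w j (U2 w) (P2 w) = (j / 3)%:M * (mon (fun p =>
  R3_coef (p.1 + p.2)) id *
    \sum_(t : 'F_3) mon (fun=> chi w (t ^+ 2 + t)) (F3_shift t)).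
  rewrite /hg quad_U2_sum; congr (_ * (_ * _)).
  rewrite quad_scale -mon1 expr2 monM !mon_scale.
  apply/matrixP=> a b; rewrite !mxE /R3_coef -!mulrDl; congr (_ * _).
  by rewrite addrA expr2.
rewrite mulr_scalar_mx mulr_sumr scaler_sumr /G3 R3_sum scaler_sumr.
apply: eq_bigr => t _; rewrite monM !mon_scale; apply: eq_mon => // -[x y] /=.
rewrite [x + t + _]addrACA subrr addr0.
have -> : t ^+ 2 + t - (x + y) ^+ 2 + (x + y) =
  (t ^+ 2 + t) + ((x + y) - (x + y) ^+ 2) by ring.
rewrite chiD // [RHS]mulrCA -R3_coefE.
by rewrite [RHS]mulrC [chi w (t ^+ 2 + t) * _]mulrC !mulrA.
Qed.

Let C3 : 3 != 0 :> R[i]. Proof. by rewrite pnatr_eq0. Qed.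

Let U3 : U2 w ^+ 3 = 1. Proof. exact/U2_cube/cube_root_cube/omega3_root. Qed.
Let P3 : P2 w ^+ 3 = 1. Proof. exact/P2_cube/cube_root_cube/omega3_root. Qed.
Let UP : U2 w * P2 w = P2 w * U2 w. Proof. exact/U2P2. Qed.

Lemma G3K : G3 R * hgV scalar_mx w j (U2 w) (P2 w) = 1.
Proof.
rewrite G3E.
exact: (hgK (@central_scalar_mx _ _) omega3_root rB_sqr C3 U3 P3 UP).
Qed.

Lemma invmx_G3 : invmx (G3 R) = hgV scalar_mx w j (U2 w) (P2 w).
Proof.
have [GU _] := mulmx1_unit G3K.
by rewrite -[RHS](mulKmx GU) [_ *m hgV _ _ _ _ _]G3K mulmx1.
Qed.

Lemma E3E : E3 R = he scalar_mx (U2 w) (P2 w).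
Proof.
have skein := h_skein (@central_scalar_mx _ _) omega3_root rB_sqr C3 (U2 w)
  (P2 w).
rewrite /E3 invmx_G3 G3E qB_diff skein.
have j0 : j != 0 by apply: contra_eq_neq rB_sqr => ->;
  rewrite expr0n eq_sym oppr_eq0 oner_eq0.
move: (he _ _ _) => e; rewrite (mulr_scalar_mx j) scalerA mulVf // scale1r.
by rewrite opprB addrC subrK.
Qed.

Lemma local_copy_G3 n (i : 'I_n.-1) : local_copy (G3 R) i =
  hg scalar_mx w j (Uop w i) (Pop w i).
Proof. by rewrite G3E; exact: local_op_pair. Qed.

Lemma local_copy_E3 n (i : 'I_n.-1) : local_copy (E3 R) i =
  he scalar_mx (Uop w i) (Pop w i).
Proof. by rewrite E3E; exact: local_op_pair. Qed.

End Constants.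

(** * Faithfulness and strict localization *)

Section StrictLocalization.
Variable R : realType.
Local Notation q := (qB R).
Local Notation w := (omega3 R).
Local Notation j := (rB R).
Local Notation rho n := (rep_lrmorphism (omega3_root R) (rB_sqr R) (qB_diff R)
  n).

Let q0 : q != 0.
Proof. by apply: contra_eq_neq (qB_pow4 R) => ->;
  rewrite !expr0n sub0r eq_sym oppr_eq0 oner_eq0. Qed.

Let j0 : j != 0.
Proof. by rewrite expf_neq0. Qed.

Let qq0 : q - q^-1 != 0.
Proof. by rewrite qB_diff. Qed.

Lemma rho_g n (i : 'I_n.-1) : rho n (bmw_g j q i) = local_copy (G3 R) i.
Proof. by rewrite local_copy_G3;
  exact: (rep_gen (omega3_root R) (rB_sqr R) (qB_diff R)). Qed.

Lemma rho_e n (i : 'I_n.-1) : rho n (bmw_e j q i) = local_copy (E3 R) i.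
Proof. by rewrite local_copy_E3;
  exact: (rep_gen (omega3_root R) (rB_sqr R) (qB_diff R)). Qed.

Lemma local_copy_R3 n (i : 'I_n.-1) :
  local_copy (R3 R) i = q ^- 2 *: rho n (bmw_g j q i).
Proof.
have -> : R3 R = q ^- 2 *: G3 R by rewrite scalerA mulVf ?scale1r // expf_neq0.
by rewrite rho_g -[LHS]/(local_op i _) linearZ.
Qed.

Lemma R3_yang_baxter : yang_baxter_operator (R3 R).
Proof.
split.
  have : R3 R *m (q ^+ 2 *: hgV scalar_mx w j (U2 w) (P2 w)) = 1%:M.
    by rewrite -scalemxAr scalemxAl; exact: G3K.
  by case/mulmx1_unit.
have adj3 : adjacent (ord0 : 'I_3.-1) ord_max by [].
have := congr1 (rho 3) (bmw_braid j q adj3); rewrite !rmorphM !local_copy_R3 /=.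
move: (rho 3 _) (rho 3 _) => A B AB.
have scale3 c (X Y Z : endmx R[i] {ffun 'I_3 -> 'F_3}) :
    (c *: X) *m (c *: Y) *m (c *: Z) = c ^+ 3 *: (X *m Y *m Z).
  by rewrite -!scalemxAl -!scalemxAr -!scalemxAl !scalerA -!expr2 -exprS.
by rewrite !scale3; congr (_ *: _).
Qed.

Definition rho_trace n : normalized_trace (bmwB R n) :=
  rep_normalized_trace (omega3_root R) (rB_sqr R) (qB_diff R) n.

Lemma rho_trace_markov : markov_trace rho_trace.
Proof. exact: (rep_trace_markov (omega3_root R) (rB_sqr R) (qB_diff R)). Qed.

Section Trace.
Variable tr : forall n, normalized_trace (bmwB R n).
Hypothesis trM : markov_trace tr.

(** By uniqueness the given trace is the normalized matrix trace, whose radical is the kernel of the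
    representation. *)
Lemma tr_radical n (a : bmwB R n) : trace_radical (tr n) a <-> rho n a = 0.
Proof.
have E b : tr n b = rho_trace n b :=
  markov_unique j0 qq0 trM rho_trace_markov b.
have [r1 r2] := rep_trace_radical (omega3_root R) (rB_sqr R) (qB_diff R) a.
by split=> [ra|a0 b]; [apply: r1 => b; rewrite -[LHS]E | rewrite E; exact: r2].
Qed.

Lemma rho_ss n : exists phi : {lrmorphism bmw_ss tr n ->
  endmx R[i] {ffun 'I_n -> 'F_3}},
  (forall a : bmwB R n, phi (tclass (tr n) a) = rho n a) /\ injective phi.
Proof.
have rho0 a : trace_radical (tr n) a -> rho n a = 0 by move/tr_radical.
have [phi phiE] := quotient_lift_ex rho0.
exists phi; split=> // x y.
rewrite -(tclass_repr x) -(tclass_repr y); move: (repr x) (repr y) => a b.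
rewrite !phiE => /eqP; rewrite -subr_eq0 -rmorphB => /eqP ab.
exact/tclassP/tr_radical.
Qed.

(** An element of the radical acts by zero, hence still acts by zero after adding a strand, and so
    lies in the next radical. *)
Lemma ss_incl n : exists f : {lrmorphism bmw_ss tr n -> bmw_ss tr n.+1},
  forall a, f (tclass (tr n) a) = tclass (tr n.+1) (bmw_incl a).
Proof.
pose g : {lrmorphism bmwB R n -> bmw_ss tr n.+1} :=
  (tclass (tr n.+1) \o @bmw_incl _ j q n : {lrmorphism _ -> _}).
have g0 a : trace_radical (tr n) a -> g a = 0.
  move/tr_radical => a0; rewrite -(rmorph0 (tclass (tr n.+1))); apply/tclassP.
  rewrite subr0; apply/tr_radical.
  exact: (rep_incl_eq0 (omega3_root R) (rB_sqr R) (qB_diff R)).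
by have [f fE] := quotient_lift_ex g0; exists f.
Qed.

Lemma ss_braid_inverse n (i : 'I_n.-1) :
  two_sided_inverse (bmw_ss_braid tr i) (q ^+ 2 *: tclass (tr n)
    (bmw_gV j q i)).
Proof.
have q20 : q ^+ 2 != 0 by rewrite expf_neq0.
split; rewrite /bmw_ss_braid -scalerAl -scalerAr scalerA -rmorphM /=.
  by rewrite bmw_gK mulVf // scale1r rmorph1.
by rewrite bmw_gVK mulfV // scale1r rmorph1.
Qed.

(** The scalars q^2 and q^-2 are undone by rescaling, g^-1 comes from the inverse of the braid
    generator, and e is a combination of 1, g and g^-1. *)
Lemma ss_generated n (x : bmw_ss tr n) : generated_by
  (fun y => exists i, y = bmw_ss_braid tr i \/ two_sided_inverse
    (bmw_ss_braid tr i) y) x.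
Proof.
set S := (fun y => _); have gZ c y : generated_by S y ->
  generated_by S (c *: y).
  by move=> Sy; rewrite -[y]mul1r scalerAl; apply: generated_mul => //;
    exact: generated_scalar.
have q20 : q ^+ 2 != 0 by rewrite expf_neq0.
have Sg i : generated_by S (tclass (tr n) (bmw_g j q i)).
  rewrite -[tclass _ _]scale1r -(divff q20) -scalerA; apply/gZ/generated_gen.
  by exists i; left.
have SgV i : generated_by S (tclass (tr n) (bmw_gV j q i)).
  rewrite -[tclass _ _]scale1r -(mulVf q20) -scalerA; apply/gZ/generated_gen.
  by exists i; right; exact: ss_braid_inverse.
rewrite -(tclass_repr x); elim/bmw_ind: (repr x) =>
  [i|i|i|c|a b Sa Sb|a b Sa Sb] //.
- rewrite bmw_eE // rmorphB rmorph1 /= linearZ /= rmorphB /= -scaleN1r.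
  apply: generated_add; first by rewrite -[1]scale1r; exact: generated_scalar.
  apply/gZ/gZ/generated_add => //; rewrite -scaleN1r; exact: gZ.
- by rewrite linearZ rmorph1; exact: generated_scalar.
- by rewrite rmorphD; exact: generated_add.
- by rewrite rmorphM; exact: generated_mul.
Qed.

Lemma ss_braid_tower : braid_tower (bmw_ss_braid tr).
Proof.
move=> n; split.
- have scale3 c (x y z : bmw_ss tr n) : c *: x * (c *: y) * (c *: z) =
    c ^+ 3 *: (x * y * z).
    by rewrite -!scalerAl -!scalerAr -!scalerAl !scalerA; congr (_ *: _); ring.
  split=> i k ik.
    move=> nik; rewrite /bmw_ss_braid -!scalerAl -!scalerAr -!rmorphM /=.
    by rewrite bmw_far.
  have := congr1 (tclass (tr n)) (bmw_braid j q ik);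
    rewrite !rmorphM /= => braid.
  by rewrite /bmw_ss_braid !scale3 braid.
- by move=> i; exists (q ^+ 2 *: tclass (tr n) (bmw_gV j q i));
    exact: ss_braid_inverse.
- exact: ss_generated.
- have [f fE] := ss_incl n; exists f => i.
  by rewrite /bmw_ss_braid linearZ /= fE bmw_incl_g.
Qed.

Lemma ss_strict_localization : strict_localization (R3 R) (bmw_ss_braid tr).
Proof.
split; [exact: R3_yang_baxter | exact: ss_braid_tower | move=> n].
have [phi [phiE phi_inj]] := rho_ss n; exists phi; split=> // i.
by rewrite local_copy_R3 /bmw_ss_braid linearZ /= phiE.
Qed.

End Trace.
End StrictLocalization.

Theorem corollary12p7 (R : realType) :
  (exists tr : forall n, normalized_trace (bmwB R n), markov_trace tr) /\
  (forall tr : forall n, normalized_trace (bmwB R n), markov_trace tr ->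
    (forall n : nat, (2 <= n)%N ->
      exists rho : {lrmorphism bmwB R n -> endmx R[i] {ffun 'I_n -> 'F_3}},
        (forall i : 'I_n.-1,
          rho (bmw_g (rB R) (qB R) i) = local_copy (G3 R) i /\
          rho (bmw_e (rB R) (qB R) i) = local_copy (E3 R) i) /\
        exists rho_ss :
            {lrmorphism bmw_ss tr n -> endmx R[i] {ffun 'I_n -> 'F_3}},
          (forall a : bmwB R n, rho_ss (tclass (tr n) a) = rho a) /\
          injective rho_ss) /\
    strict_localization (R3 R) (bmw_ss_braid tr)).
Proof.
split; first by exists (@rho_trace R); exact: rho_trace_markov.
move=> tr trM; split; last exact: ss_strict_localization.
move=> n _; exists (rep_lrmorphism (omega3_root R) (rB_sqr R) (qB_diff R) n).
by split=> [i|]; [split; [exact: rho_g | exact: rho_e] | exact: rho_ss].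
Qed.
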